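(* Let $K_1\ge K_2\ge 0$ be integers, with $K_1\ge 1$ when $K_2=0$. Let $\mathrm{a}_1,\ldots,\mathrm{a}_{K_1}$ be pairwise distinct nonzero real numbers and $\mathrm{b}_1,\ldots,\mathrm{b}_{K_2}$ be pairwise distinct nonzero real numbers, and put \[ G(x,y)=\prod_{j=1}^{K_1}(x-\mathrm{a}_j)\prod_{\ell=1}^{K_2}(y-\mathrm{b}_\ell), \] where the empty product $\prod_{\ell=1}^{0}(y-\mathrm{b}_\ell)$ is $1$. Let $P(x,y),Q(x,y)$ be real polynomials of degree $n$, and consider the perturbed system \[ \dot x=-yG(x,y)+\varepsilon P(x,y),\qquad \dot y=xG(x,y)+\varepsilon Q(x,y), \] with small parameter $\varepsilon$. Let $\rho=\min_{j,\ell}\{|\mathrm{a}_j|,|\mathrm{b}_\ell|\}$ and, for $0<r<\rho$, let \[ I(r)=\int_{\gamma_r}\frac{Q(x,y)\,dx-P(x,y)\,dy}{G(x,y)},\qquad \gamma_r=\{(x,y): x^2+y^2=r^2\}, \] be the associated Abelian integral, and assume $I$ is not identically zero on $(0,\rho)$. Define \[ \widetilde K_1=\operatorname{card}\{|\mathrm{a}_1|,\ldots,|\mathrm{a}_{K_1}|\},\quad \widetilde K_2=\operatorname{card}\{|\mathrm{a}_1|,\ldots,|\mathrm{a}_{K_1}|,|\mathrm{b}_1|,\ldots,|\mathrm{b}_{K_2}|\}-\widetilde K_1, \] \[ L=\operatorname{card}\{\mathrm{a}_j^2+\mathrm{b}_\ell^2 : j=1,\ldots,K_1,\ \ell=1,\ldots,K_2\}.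 \] Then the number $\mathcal Z(I)$ of zeros of $I$ in $(0,\rho)$, counted with multiplicity, satisfies \[ \mathcal Z(I)\le \begin{cases} \widetilde K_1\left[\dfrac{n+3}{2}\right]+\left[\dfrac{n}{2}\right], & K_2=0,\\[2mm] (\widetilde K_1+\widetilde K_2)\left(\left[\dfrac{n+2}{2}\right]+L\right)+\left[\dfrac{n-1}{2}\right]+L, & K_2\ge 1. \end{cases} \] (Here $\widetilde K_1\le K_1$, $\widetilde K_2\le K_2$, $L\le K_1K_2$.)
   Context: $[s]$ denotes the integer part of a real number $s$; $\operatorname{card}$ denotes the number of distinct elements of a set. The circle $\gamma_r$ is traversed once (e.g. counterclockwise, parametrized by $(r\cos\theta,r\sin\theta)$, $\theta\in[0,2\pi]$). For $0<r<\rho$, $G$ does not vanish on $\gamma_r$, so $I(r)$ is well defined and analytic in $r$. *)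

(* Defs.v *)
From Stdlib Require Import Reals List ZArith.
From Coquelicot Require Import Coquelicot.
Open Scope R_scope.

Definition poly2 (n : nat) (c : nat -> nat -> R) (x y : R) : R :=
  sum_f_R0 (fun i => sum_f_R0 (fun j => c i j * x ^ i * y ^ j) (n - i)) n.

Definition prod_lin (l : list R) (t : R) : R :=
  fold_right (fun a acc => (t - a) * acc) 1 l.

Definition Gfun (la lb : list R) (x y : R) : R := prod_lin la x * prod_lin lb y.

(* rho = min of |a_j|, |b_l| (la is assumed nonempty) *)
Definition rho (la lb : list R) : R :=
  fold_right (fun a m => Rmin (Rabs a) m) (Rabs (hd 0 la)) (la ++ lb).

(* Abelian integral I(r) = \oint_{gamma_r} (Q dx - P dy)/G, with gamma_r
   parametrized counterclockwise by (r cos t, r sin t), t in [0, 2 pi]. *)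
Definition abelian_I (la lb : list R) (P Q : R -> R -> R) (r : R) : R :=
  RInt (fun t =>
          (Q (r * cos t) (r * sin t) * (- r * sin t)
           - P (r * cos t) (r * sin t) * (r * cos t))
          / Gfun la lb (r * cos t) (r * sin t)) 0 (2 * PI).

Definition card_R (l : list R) : nat := length (nodup Req_dec_T l).

Definition K1t (la : list R) : nat := card_R (map Rabs la).
Definition K2t (la lb : list R) : nat :=
  (card_R (map Rabs la ++ map Rabs lb) - K1t la)%nat.
Definition Lcard (la lb : list R) : nat :=
  card_R (flat_map (fun a => map (fun b => a ^ 2 + b ^ 2) lb) la).

Definition zero_bound (n : nat) (la lb : list R) : Z :=
  let nz := Z.of_nat n in
  match lb with
  | nil => (Z.of_nat (K1t la) * ((nz + 3) / 2) + nz / 2)%Z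
  | _ => (Z.of_nat (K1t la + K2t la lb) * ((nz + 2) / 2 + Z.of_nat (Lcard la lb))
          + (nz - 1) / 2 + Z.of_nat (Lcard la lb))%Z
  end.

Definition sum_mult (zs : list (R * nat)) : nat :=
  fold_right (fun z s => (snd z + s)%nat) 0%nat zs.

(* Main.v *)
(* Put s = r^2. Partial fractions in x and in y, the recursions
     x^(i+2) / (y - b) = (r^2 - b^2) x^i / (y - b) - x^i (y + b),
     (a^2 + b^2 - r^2) / ((x - a)(y - b)) = - (x + a) / (y - b) - (y + b) / (x - a)
   on the circle, and the Poisson integral of 1 / (x - a) give
     prod_v (s - v) * I = p_0(s) + sum_u p_u(s) (u^2 - s)^(-1/2),
   where v runs over the values a^2 + b^2, u over the values |a|, |b|, and the
   p's are polynomials of controlled degree.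

   Such functions obey a Chebyshev bound: a nonzero one has fewer zeros than
   coefficients. By Rolle's theorem each derivation costs one zero, and p_0
   disappears after deg p_0 + 1 derivations. To remove a term u_1 next,
   multiply by a power of u_1^2 - s that turns it into a polynomial of degree d
   in 1 / (u_1^2 - s), and differentiate with respect to this variable, that is
   apply (u_1^2 - s)^2 d/ds, d + 1 times. All terms having the same
   homogeneity, the degrees of the other p's do not grow. *)

Require Import Defs.
From Stdlib Require Import Reals List ZArith Lra Lia.
From Coquelicot Require Import Coquelicot.
Open Scope R_scope.

(** * Zeros with multiplicity and Rolle's theorem *)

Lemma is_derive_Rmult (f g : R -> R) (x df dg : R) :
  is_derive f x df -> is_derive g x dg ->
  is_derive (fun y => f y * g y) x (df * g x + f x * dg).
Proof. intros Hf Hg. exact (is_derive_mult f g x df dg Hf Hg Rmult_comm). Qed.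

Lemma is_derive_Rplus (f g : R -> R) (x df dg : R) :
  is_derive f x df -> is_derive g x dg ->
  is_derive (fun y => f y + g y) x (df + dg).
Proof. intros Hf Hg. exact (is_derive_plus f g x df dg Hf Hg). Qed.

Section Interval.

Variables lo hi : R.

Definition deriv_on (f f' : R -> R) : Prop :=
  forall x, lo < x < hi -> is_derive f x (f' x).

Lemma locally_between (P : R -> Prop) (x : R) :
  lo < x < hi -> (forall y, lo < y < hi -> P y) -> locally x P.
Proof.
  intros Hx H. apply (locally_interval P x lo hi); simpl; try apply Hx.
  intros y H1 H2. apply H; auto.
Qed.

Lemma deriv_on_ext (f g f' : R -> R) :
  (forall x, lo < x < hi -> f x = g x) -> deriv_on f f' -> deriv_on g f'.
Proof.
  intros E D x Hx. apply is_derive_ext_loc with f; auto.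
  apply locally_between; auto.
Qed.

Lemma deriv_on_unique (f f' f'' : R -> R) :
  deriv_on f f' -> deriv_on f f'' -> forall x, lo < x < hi -> f' x = f'' x.
Proof.
  intros H1 H2 x Hx.
  rewrite <- (is_derive_unique _ _ _ (H1 x Hx)).
  exact (is_derive_unique _ _ _ (H2 x Hx)).
Qed.

Lemma deriv_on_mult (f g f' g' : R -> R) :
  deriv_on f f' -> deriv_on g g' ->
  deriv_on (fun x => f x * g x) (fun x => f' x * g x + f x * g' x).
Proof. intros Hf Hg x Hx. apply is_derive_Rmult; auto. Qed.

Lemma deriv_on_plus (f g f' g' : R -> R) :
  deriv_on f f' -> deriv_on g g' ->
  deriv_on (fun x => f x + g x) (fun x => f' x + g' x).
Proof. intros Hf Hg x Hx. apply is_derive_Rplus; auto. Qed.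

(** Derivatives are witness functions that are valid inside the interval, not values of the total
    function [Derive], so closure under sums and products is a plain induction. *)
Fixpoint smooth (n : nat) (f : R -> R) : Prop :=
  match n with
  | O => True
  | S m => exists f', deriv_on f f' /\ smooth m f'
  end.

(** Encodes a zero of order at least m. By [deriv_on_unique] the choice of the witness is immaterial
    on the interval. Even order 1 includes differentiability, which is why the Rolle lemmas below
    take a second derivative [f'']. *)
Fixpoint vanishes (m : nat) (f : R -> R) (z : R) : Prop :=
  match m with
  | O => True
  | S k => f z = 0 /\ exists f', deriv_on f f' /\ vanishes k f' z
  end.

Lemma smooth_pred (n : nat) : forall f, smooth (S n) f -> smooth n f.
Proof.
  induction n as [|n IH]; intros f H; [exact I|].
  destruct H as (f' & D & S). exists f'. split; auto.
Qed.

Lemma smooth_plus (n : nat) : forall f g,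
  smooth n f -> smooth n g -> smooth n (fun x => f x + g x).
Proof.
  induction n as [|n IH]; intros f g Hf Hg; [exact I|].
  destruct Hf as (f' & Df & Sf), Hg as (g' & Dg & Sg).
  exists (fun x => f' x + g' x). split; auto using deriv_on_plus.
Qed.

Lemma smooth_mult (n : nat) : forall f g,
  smooth n f -> smooth n g -> smooth n (fun x => f x * g x).
Proof.
  induction n as [|n IH]; intros f g Hf Hg; [exact I|].
  assert (Sf0 := smooth_pred _ _ Hf). assert (Sg0 := smooth_pred _ _ Hg).
  destruct Hf as (f' & Df & Sf), Hg as (g' & Dg & Sg).
  exists (fun x => f' x * g x + f x * g' x).
  split; auto using deriv_on_mult, smooth_plus.
Qed.

Lemma smooth_const (n : nat) : forall c : R, smooth n (fun _ => c).
Proof.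
  induction n as [|n IH]; intros c; [exact I|].
  exists (fun _ => 0). split; auto.
  intros x _. apply @is_derive_const.
Qed.

Lemma smooth_id (n : nat) : smooth n (fun x => x).
Proof.
  destruct n as [|n]; [exact I|].
  exists (fun _ => 1). split; [|apply smooth_const].
  intros x _. apply @is_derive_id.
Qed.

Lemma vanishes_ext (m : nat) : forall (f g : R -> R) (z : R), lo < z < hi ->
  (forall x, lo < x < hi -> f x = g x) -> vanishes m f z -> vanishes m g z.
Proof.
  destruct m as [|m]; simpl; auto.
  intros f g z Hz E (Z & f' & D & V). split; [rewrite <- E; auto|].
  exists f'. split; auto. apply deriv_on_ext with f; auto.
Qed.

Lemma vanishes_pred (m : nat) : forall f z, vanishes (S m) f z -> vanishes m f z.
Proof.
  induction m as [|m IH]; intros f z H; [exact I|].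
  destruct H as (Z & f' & D & V). split; auto. exists f'. auto.
Qed.

Lemma vanishes_plus (m : nat) : forall f g z,
  vanishes m f z -> vanishes m g z -> vanishes m (fun x => f x + g x) z.
Proof.
  induction m as [|m IH]; intros f g z Hf Hg; [exact I|].
  destruct Hf as (Zf & f' & Df & Vf), Hg as (Zg & g' & Dg & Vg).
  split; [rewrite Zf, Zg; ring|].
  exists (fun x => f' x + g' x). split; auto using deriv_on_plus.
Qed.

Lemma vanishes_mult (m : nat) : forall f g z,
  smooth m g -> vanishes m f z -> vanishes m (fun x => g x * f x) z.
Proof.
  induction m as [|m IH]; intros f g z Hg Hf; [exact I|].
  assert (Sg0 := smooth_pred _ _ Hg). assert (Vf0 := vanishes_pred _ _ _ Hf).
  destruct Hf as (Zf & f' & Df & Vf), Hg as (g' & Dg & Sg).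
  split; [rewrite Zf; ring|].
  exists (fun x => g' x * f x + g x * f' x).
  split; [apply deriv_on_mult | apply vanishes_plus]; auto.
Qed.

(** Link with the multiplicities of the theorem: [Derive_n] has a value even where no derivative
    exists, and [smooth] supplies the genuine derivatives that [vanishes] wants. *)
Lemma vanishes_Derive_n (m : nat) : forall f z, lo < z < hi ->
  smooth m f -> (forall k, (k < m)%nat -> Derive_n f k z = 0) ->
  vanishes m f z.
Proof.
  induction m as [|m IH]; intros f z Hz Hf H; [exact I|].
  destruct Hf as (f' & D & Sf). split; [apply (H O); lia|].
  exists f'. split; auto. apply IH; auto.
  intros k Hk. rewrite <- (H (S k)) by lia.
  (* [Derive_n] unfolds at its outermost derivation; the sum form splits off the innermost one,
     which is where [f'] sits. *)
  replace (S k) with (k + 1)%nat by lia.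
  rewrite <- Derive_n_comp. apply Derive_n_ext_loc.
  apply locally_between; auto.
  intros y Hy. symmetry. apply is_derive_unique. auto.
Qed.

(** The argument x is a running strict lower bound, so positions increase strictly and Rolle's
    theorem applies between neighbours. Entries of multiplicity 0 are allowed and have to be skipped
    in the arguments below. *)
Fixpoint sorted_zeros (f : R -> R) (x : R) (zs : list (R * nat)) : Prop :=
  match zs with
  | nil => True
  | (z, m) :: zs' => x < z < hi /\ vanishes m f z /\ sorted_zeros f z zs'
  end.

Lemma sorted_zeros_lt (f : R -> R) (x y : R) (zs : list (R * nat)) :
  x <= y -> sorted_zeros f y zs -> sorted_zeros f x zs.
Proof.
  destruct zs as [|[z m] zs]; simpl; auto.
  intros H (H1 & H2 & H3). repeat split; auto; lra.
Qed.

Lemma sorted_zeros_mult (g f : R -> R) (zs : list (R * nat)) :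
  (forall n, smooth n g) -> forall x,
  sorted_zeros f x zs -> sorted_zeros (fun x => g x * f x) x zs.
Proof.
  intros Hg. induction zs as [|[z m] zs IH]; simpl; auto.
  intros x (H1 & H2 & H3). repeat split; try apply H1; auto.
  apply vanishes_mult; auto.
Qed.

Lemma sorted_zeros_ext (g f : R -> R) (zs : list (R * nat)) :
  (forall x, lo < x < hi -> f x = g x) -> forall x, lo <= x ->
  sorted_zeros f x zs -> sorted_zeros g x zs.
Proof.
  intros Hg. induction zs as [|[z m] zs IH]; simpl; auto.
  intros x Hx (H1 & H2 & H3). repeat split; try apply H1.
  - apply vanishes_ext with f; auto. lra.
  - apply IH; auto. lra.
Qed.

Lemma sort_insert (f : R -> R) (z : R) (m : nat) (zs : list (R * nat)) :
  vanishes m f z -> forall x, x < z < hi -> sorted_zeros f x zs ->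
  ~ In z (map fst zs) ->
  exists zs', sorted_zeros f x zs' /\ sum_mult zs' = (m + sum_mult zs)%nat /\
    forall y, In y (map fst zs') -> y = z \/ In y (map fst zs).
Proof.
  intros V. induction zs as [|[z1 m1] zs IH]; intros x Hx Hs Hn.
  - exists ((z, m) :: nil). repeat split; simpl; auto; try apply Hx.
    intros y [E|[]]; auto.
  - destruct Hs as (H1 & V1 & Hs). simpl in Hn.
    destruct (Rlt_le_dec z z1) as [Hl|Hl].
    + exists ((z, m) :: (z1, m1) :: zs). repeat split; simpl; auto; try lra.
      intros y [E|E]; auto.
    + destruct (IH z1) as (zs' & S' & M' & I'); auto.
      { split; [|lra]. destruct Hl as [|E]; [auto|exfalso; auto]. }
      exists ((z1, m1) :: zs'). repeat split; simpl; auto; try apply H1.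
      * unfold sum_mult in *. simpl. lia.
      * intros y [E|E]; auto. destruct (I' y E); auto.
Qed.

Lemma sort_zeros (f : R -> R) (zs : list (R * nat)) :
  NoDup (map fst zs) ->
  (forall z, In z zs -> lo < fst z < hi /\ vanishes (snd z) f (fst z)) ->
  exists zs', sorted_zeros f lo zs' /\ sum_mult zs' = sum_mult zs.
Proof.
  intros Hd Hz.
  (* The extra clause on positions carries [NoDup] through the induction: it shows that the next
     zero to insert is not yet in the sorted list. *)
  cut (exists zs', sorted_zeros f lo zs' /\ sum_mult zs' = sum_mult zs /\
         forall y, In y (map fst zs') -> In y (map fst zs)).
  { intros (zs' & A & B & _). eauto. }
  induction zs as [|[z m] zs IH].
  - exists nil. simpl. auto.
  - inversion Hd as [|? ? Hn Hd']; subst.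
    destruct IH as (zs' & S' & M' & I'); auto.
    { intros y Hy. apply Hz. simpl; auto. }
    destruct (Hz (z, m)) as (B & V); [simpl; auto|]. simpl in B, V.
    destruct (sort_insert f z m zs' V lo B S') as (zs'' & S'' & M'' & I'').
    { intro H. apply Hn. apply I'. exact H. }
    exists zs''. repeat split; auto.
    + rewrite M'', M'. reflexivity.
    + intros y Hy. simpl. destruct (I'' y Hy); auto.
Qed.

(** * Rolle's theorem for lists of zeros with multiplicity *)

Lemma Rolle_between (f f' : R -> R) (a b : R) :
  deriv_on f f' -> lo < a -> a < b -> b < hi -> f a = 0 -> f b = 0 ->
  exists c, a < c < b /\ f' c = 0.
Proof.
  intros D Ha Hab Hb Fa Fb.
  assert (pr : forall x, a < x < b -> derivable_pt f x).
  { intros x Hx. exists (f' x). apply is_derive_Reals. apply D. lra. }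
  destruct (Rolle f a b pr) as (c & P & E); auto; try lra.
  - intros x Hx. apply derivable_continuous_pt. exists (f' x).
    apply is_derive_Reals. apply D. lra.
  - exists c. split; auto.
    apply derive_pt_eq_1, is_derive_Reals, is_derive_unique in E.
    rewrite <- E. symmetry. apply is_derive_unique. apply D. lra.
Qed.

(** A zero z to the left of the list is at hand, so each unit of multiplicity lost at a point is
    repaid by a new zero of [f'] between it and its predecessor: nothing is lost in total. *)
Lemma Rolle_after (f f' f'' : R -> R) (zs : list (R * nat)) :
  deriv_on f f' -> deriv_on f' f'' ->
  forall z, lo < z -> f z = 0 -> sorted_zeros f z zs ->
  exists zs', sorted_zeros f' z zs' /\ (sum_mult zs <= sum_mult zs')%nat.
Proof.
  intros D D'. induction zs as [|[z1 m] zs IH]; intros z Hz Fz Hs.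
  - exists nil. simpl. auto.
  - destruct Hs as (B & V & Hs). destruct m as [|m].
    + destruct (IH z) as (zs' & S' & M'); auto.
      { apply sorted_zeros_lt with z1; auto; lra. }
      exists zs'. auto.
    + destruct V as (F1 & g & Dg & V).
      destruct (IH z1) as (zs' & S' & M'); auto; try lra.
      destruct (Rolle_between f f' z z1) as (c & Hc & Fc); auto; try lra.
      exists ((c, 1%nat) :: (z1, m) :: zs').
      split; [|unfold sum_mult in *; simpl; lia].
      repeat split; simpl; auto; try lra; eauto.
      apply vanishes_ext with g; auto; try lra.
      apply (deriv_on_unique f); auto.
Qed.

(** The first zero of positive multiplicity has no predecessor and costs one unit; [Rolle_after]
    handles those behind it without loss. *)
Lemma Rolle_sorted (f f' f'' : R -> R) (zs : list (R * nat)) :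
  deriv_on f f' -> deriv_on f' f'' ->
  forall z, lo <= z -> sorted_zeros f z zs ->
  exists zs', sorted_zeros f' z zs' /\ (sum_mult zs <= S (sum_mult zs'))%nat.
Proof.
  intros D D'. induction zs as [|[z1 m] zs IH]; intros z Hz Hs.
  - exists nil. simpl. auto.
  - destruct Hs as (B & V & Hs). destruct m as [|m].
    + apply IH; auto. apply sorted_zeros_lt with z1; auto; lra.
    + destruct V as (F1 & g & Dg & V).
      destruct (Rolle_after f f' f'' zs D D' z1) as (zs' & S' & M'); auto; try lra.
      exists ((z1, m) :: zs').
      split; [|unfold sum_mult in *; simpl; lia].
      repeat split; simpl; auto; try lra.
      apply vanishes_ext with g; auto; try lra.
      apply (deriv_on_unique f); auto.
Qed.

(** Contrapositive form of the Chebyshev bound, chosen because it passes through derivation. At N =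
    0 the empty list makes it say that f is identically zero, which starts the inductions. *)
Definition forced_zero (N : nat) (f : R -> R) : Prop :=
  (exists zs, sorted_zeros f lo zs /\ (N <= sum_mult zs)%nat) ->
  forall x, lo < x < hi -> f x = 0.

Lemma forced_zero_ext (N : nat) (f g : R -> R) :
  (forall x, lo < x < hi -> f x = g x) -> forced_zero N g -> forced_zero N f.
Proof.
  intros E T (zs & S & M) x Hx. rewrite E by auto. apply T; auto.
  exists zs. split; auto. apply sorted_zeros_ext with f; auto. lra.
Qed.

Lemma forced_zero_factor (N : nat) (h f : R -> R) :
  (forall n, smooth n h) -> (forall x, lo < x < hi -> h x <> 0) ->
  forced_zero N (fun x => h x * f x) -> forced_zero N f.
Proof.
  intros Sh Nh T (zs & S & M) x Hx.
  assert (E : h x * f x = 0).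
  { apply T; auto. exists zs. split; auto. apply sorted_zeros_mult; auto. }
  apply Rmult_integral in E. destruct E as [E|E]; auto. destruct (Nh x Hx E).
Qed.

Lemma sorted_zeros_exists (f : R -> R) (zs : list (R * nat)) :
  forall x, sorted_zeros f x zs -> (1 <= sum_mult zs)%nat ->
  exists z, x < z < hi /\ f z = 0.
Proof.
  induction zs as [|[z m] zs IH]; intros x Hs Hm; simpl in *; [lia|].
  destruct Hs as (B & V & Hs). destruct m as [|m].
  - destruct (IH z) as (y & Hy & Fy); auto. exists y. split; auto. lra.
  - exists z. split; auto. apply V.
Qed.

Lemma deriv_on_zero (f : R -> R) (a b : R) :
  deriv_on f (fun _ => 0) -> lo < a < hi -> lo < b < hi -> f a = f b.
Proof.
  intros D Ha Hb.
  destruct (MVT_gen f a b (fun _ => 0)) as (c & _ & E).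
  - intros x Hx. apply D. unfold Rmin, Rmax in Hx. destruct Rle_dec; lra.
  - intros x Hx. apply derivable_continuous_pt. exists 0.
    apply is_derive_Reals. apply D. unfold Rmin, Rmax in Hx. destruct Rle_dec; lra.
  - lra.
Qed.

(** S N zeros of f leave N zeros of [f'], hence of g, as w has no zeros. Then [f'] is identically
    zero, so f is constant, and one of its zeros makes the constant 0. The weight w is the room for
    a change of variable in the derivation. *)
Lemma forced_zero_deriv (N : nat) (w f f' g : R -> R) :
  smooth 2 f -> deriv_on f f' ->
  (forall n, smooth n w) -> (forall x, lo < x < hi -> w x <> 0) ->
  (forall x, lo < x < hi -> g x = w x * f' x) ->
  forced_zero N g -> forced_zero (S N) f.
Proof.
  intros (h & Dh & k & Dk & _) D Sw Nw E T (zs & S & M) x Hx.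
  assert (Eh := deriv_on_unique _ _ _ Dh D).
  assert (D' : deriv_on f' k) by (apply deriv_on_ext with h; auto).
  destruct (Rolle_sorted f f' k zs D D' lo) as (zs' & S' & M'); auto; try lra.
  assert (Z : forced_zero N f').
  { apply forced_zero_factor with w; auto.
    apply forced_zero_ext with g; auto. intros; symmetry; auto. }
  assert (Z' : forall y, lo < y < hi -> f' y = 0).
  { apply Z. exists zs'. split; auto. lia. }
  destruct (sorted_zeros_exists f zs lo S) as (z & Hz & Fz); [lia|].
  rewrite <- Fz. apply deriv_on_zero; auto.
  intros y Hy. rewrite <- (Z' y Hy). auto.
Qed.

End Interval.

(** * A Chebyshev property *)

(* [k] bounds the number of coefficients, so that [k = 0] is the zero polynomial. *)
Fixpoint is_poly (k : nat) (p : R -> R) : Prop :=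
  match k with
  | O => forall s, p s = 0
  | S j => exists q c, is_poly j q /\ forall s, p s = q s + c * s ^ j
  end.

Lemma is_poly_ext (k : nat) (p q : R -> R) :
  (forall s, p s = q s) -> is_poly k p -> is_poly k q.
Proof.
  destruct k as [|k]; simpl.
  - intros E H s. rewrite <- E. auto.
  - intros E (p0 & c & H0 & H). exists p0, c. split; auto.
    intros s. rewrite <- E. auto.
Qed.

Lemma is_poly_0 (k : nat) : is_poly k (fun _ => 0).
Proof.
  induction k as [|k IH]; simpl; auto.
  exists (fun _ => 0), 0. split; auto. intros; ring.
Qed.

Lemma is_poly_le (j k : nat) (p : R -> R) :
  (j <= k)%nat -> is_poly j p -> is_poly k p.
Proof.
  induction 1 as [|k _ IH]; auto. intros H.
  exists p, 0. split; auto. intros; ring.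
Qed.

Lemma is_poly_plus (k : nat) : forall p q,
  is_poly k p -> is_poly k q -> is_poly k (fun s => p s + q s).
Proof.
  induction k as [|k IH]; simpl; intros p q Hp Hq.
  - intros s. rewrite Hp, Hq. ring.
  - destruct Hp as (p0 & c & P0 & Hp), Hq as (q0 & d & Q0 & Hq).
    exists (fun s => p0 s + q0 s), (c + d). split; auto.
    intros s. rewrite Hp, Hq. ring.
Qed.

Lemma is_poly_scal (k : nat) (a : R) : forall p,
  is_poly k p -> is_poly k (fun s => a * p s).
Proof.
  induction k as [|k IH]; simpl; intros p Hp.
  - intros s. rewrite Hp. ring.
  - destruct Hp as (p0 & c & P0 & Hp).
    exists (fun s => a * p0 s), (a * c). split; auto.
    intros s. rewrite Hp. ring.
Qed.

Lemma is_poly_mult_id (k : nat) : forall p,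
  is_poly k p -> is_poly (S k) (fun s => s * p s).
Proof.
  induction k as [|k IH]; intros p Hp.
  - apply is_poly_ext with (fun _ => 0); [|apply is_poly_0].
    intros s. simpl in Hp. rewrite Hp. ring.
  - destruct Hp as (p0 & c & P0 & Hp).
    exists (fun s => s * p0 s), c. split; [apply (IH p0 P0)|].
    intros s. rewrite Hp. simpl. ring.
Qed.

Lemma is_poly_mult_sub (k : nat) (v : R) (p : R -> R) :
  is_poly k p -> is_poly (S k) (fun s => (v - s) * p s).
Proof.
  intros H. apply is_poly_ext with (fun s => v * p s + (-1) * (s * p s)).
  - intros; ring.
  - apply is_poly_plus.
    + apply is_poly_scal. apply is_poly_le with k; auto.
    + apply is_poly_scal, is_poly_mult_id, H.
Qed.

Lemma is_poly_monomial (k i : nat) (a : R) :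
  (i < k)%nat -> is_poly k (fun s => a * s ^ i).
Proof.
  intros H. apply is_poly_le with (S i); auto.
  exists (fun _ => 0), a. split; [apply is_poly_0|]. intros; ring.
Qed.

Lemma is_derive_monomial (c x : R) (k : nat) :
  is_derive (fun s => c * s ^ k) x (c * (INR k * x ^ pred k)).
Proof. auto_derive; auto; ring. Qed.

Lemma is_poly_derive (k : nat) : forall p, is_poly k p ->
  (forall x, is_derive p x (Derive p x)) /\ is_poly (pred k) (Derive p).
Proof.
  induction k as [|k IH]; intros p Hp.
  - assert (D : forall x, is_derive p x 0).
    { intros x. apply is_derive_ext with (fun _ => 0).
      - intros; symmetry; apply Hp.
      - apply @is_derive_const. }
    assert (D' : forall x, Derive p x = 0) by (intros; apply is_derive_unique; auto).
    split; auto. intros x. rewrite D'. auto.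
  - destruct Hp as (q & c & Q & Hp). destruct (IH q Q) as (Dq & Pq).
    assert (D : forall x, is_derive p x (Derive q x + c * (INR k * x ^ pred k))).
    { intros x. apply is_derive_ext with (fun s => q s + c * s ^ k).
      - intros; symmetry; apply Hp.
      - apply is_derive_Rplus; auto using is_derive_monomial. }
    assert (D' : forall x, Derive p x = Derive q x + c * (INR k * x ^ pred k))
      by (intros; apply is_derive_unique; auto).
    split.
    + intros x. rewrite D'. auto.
    + apply is_poly_ext with (fun x => Derive q x + c * INR k * x ^ pred k).
      { intros; rewrite D'; ring. }
      destruct k as [|k]; simpl pred in *.
      * simpl in *. intros s. rewrite Pq. ring.
      * apply is_poly_plus; [apply is_poly_le with k; auto|].
        apply is_poly_monomial. lia.
Qed.

Lemma Derive_top (j : nat) (p q : R -> R) (c : R) :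
  is_poly j q -> (forall s, p s = q s + c * s ^ j) ->
  forall s, Derive p s = Derive q s + c * (INR j * s ^ pred j).
Proof.
  intros Q E s. apply is_derive_unique.
  apply is_derive_ext with (fun s => q s + c * s ^ j).
  - intros; symmetry; apply E.
  - apply is_derive_Rplus; [|apply is_derive_monomial].
    apply (is_poly_derive j q Q).
Qed.

Lemma is_poly_derive_sub (k : nat) (c : R) (p : R -> R) :
  is_poly k p -> is_poly k (fun s => (c - s) * Derive p s).
Proof.
  intros H. destruct (is_poly_derive k p H) as (_ & H').
  destruct k as [|k]; simpl pred in H'.
  - intros s. rewrite H'. ring.
  - apply is_poly_mult_sub; auto.
Qed.

(* The leading terms cancel. *)
Lemma is_poly_drop (j : nat) (c : R) (q : R -> R) : is_poly (S j) q ->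
  is_poly j (fun s => (c - s) * Derive q s + INR j * q s).
Proof.
  intros (q0 & a & Q & E).
  (* The top term a s^j of q contributes (c - s) a j s^(j-1) + j a s^j = a j c s^(j-1). *)
  apply is_poly_ext with (fun s =>
    ((c - s) * Derive q0 s + INR j * q0 s) + (a * INR j * c) * s ^ pred j).
  - intros s. rewrite (Derive_top j q q0 a Q E), E.
    destruct j as [|j]; [simpl; ring|]. simpl pred. simpl pow. ring.
  - apply is_poly_plus.
    + apply is_poly_plus; [apply is_poly_derive_sub | apply is_poly_scal]; auto.
    + destruct j as [|j]; [simpl; intros; ring|].
      apply is_poly_monomial. simpl. lia.
Qed.

(* The top coefficient of the naive degree bound is proportional to [d + gam - del]. *)
Lemma is_poly_stay (d : nat) (c1 c gam del : R) (p : R -> R) :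
  gam - del = - INR d -> is_poly (S d) p ->
  is_poly (S d) (fun s => (c1 - s) * ((c - s) * Derive p s)
                   + (- gam) * ((c - s) * p s) + del * ((c1 - s) * p s)).
Proof.
  intros Hgd (q & a & Q & E).
  apply is_poly_ext with (fun s =>
    ((c1 - s) * ((c - s) * Derive q s)
       + (- gam) * ((c - s) * q s) + del * ((c1 - s) * q s))
    + ((a * INR d * c1 * c) * s ^ pred d
       + (a * (- INR d * (c1 + c) - gam * c + del * c1)) * s ^ d)).
  - intros s. rewrite (Derive_top d p q a Q E), E.
    replace del with (gam + INR d) by lra.
    destruct d as [|d]; [simpl; ring|]. simpl pred. simpl pow. ring.
  - repeat apply is_poly_plus.
    + apply is_poly_mult_sub, is_poly_derive_sub, Q.
    + apply is_poly_scal, is_poly_mult_sub, Q.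
    + apply is_poly_scal, is_poly_mult_sub, Q.
    + apply is_poly_monomial. lia.
    + apply is_poly_monomial. lia.
Qed.

(** * Zeros of sums of polynomials times real powers *)

Lemma Rpower_succ (x e : R) : 0 < x -> Rpower x (e + 1) = x * Rpower x e.
Proof. intros H. rewrite Rpower_plus, Rpower_1 by auto. ring. Qed.

Definition lsum (us : list R) (g : R -> R) : R :=
  fold_right (fun u acc => g u + acc) 0 us.

Lemma lsum_cons (u : R) (us : list R) (g : R -> R) :
  lsum (u :: us) g = g u + lsum us g.
Proof. reflexivity. Qed.

Lemma lsum_ext (us : list R) (g h : R -> R) :
  (forall u, In u us -> g u = h u) -> lsum us g = lsum us h.
Proof.
  induction us as [|u us IH]; simpl; auto. intros H.
  rewrite H, IH; auto.
Qed.

Lemma lsum_scal (us : list R) (a : R) (g : R -> R) :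
  a * lsum us g = lsum us (fun u => a * g u).
Proof. induction us as [|u us IH]; simpl; [ring|]. rewrite <- IH. ring. Qed.

Lemma lsum_plus (us : list R) (g h : R -> R) :
  lsum us g + lsum us h = lsum us (fun u => g u + h u).
Proof. induction us as [|u us IH]; simpl; [ring|]. rewrite <- IH. ring. Qed.

Section Chebyshev.

Variables lo hi : R.

Lemma deriv_on_poly (k : nat) (p : R -> R) :
  is_poly k p -> deriv_on lo hi p (Derive p).
Proof. intros H x _. apply (is_poly_derive k p H). Qed.

Lemma smooth_poly (n : nat) : forall k p, is_poly k p -> smooth lo hi n p.
Proof.
  induction n as [|n IH]; intros k p H; [exact I|].
  exists (Derive p). split; [apply (deriv_on_poly k), H|].
  apply IH with (pred k). apply (is_poly_derive k p H).
Qed.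

Lemma deriv_on_Rpower (c e : R) : hi <= c ->
  deriv_on lo hi (fun x => Rpower (c - x) e) (fun x => - e * Rpower (c - x) (e - 1)).
Proof.
  intros Hc x Hx.
  replace (- e * Rpower (c - x) (e - 1)) with ((-1) * (e * Rpower (c - x) (e - 1))) by ring.
  apply (is_derive_comp (fun y => Rpower y e) (fun y => c - y)).
  - apply is_derive_Reals, derivable_pt_lim_power. lra.
  - auto_derive; auto; ring.
Qed.

Lemma smooth_Rpower (c : R) : hi <= c ->
  forall n e, smooth lo hi n (fun x => Rpower (c - x) e).
Proof.
  intros Hc. induction n as [|n IH]; intros e; [exact I|].
  exists (fun x => - e * Rpower (c - x) (e - 1)).
  split; [apply deriv_on_Rpower, Hc|].
  apply smooth_mult; auto using smooth_const.
Qed.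

Lemma Rpower_nonzero (x e : R) : Rpower x e <> 0.
Proof. apply Rgt_not_eq, exp_pos. Qed.

Lemma deriv_on_lsum (us : list R) (g g' : R -> R -> R) :
  (forall u, In u us -> deriv_on lo hi (g u) (g' u)) ->
  deriv_on lo hi (fun s => lsum us (fun u => g u s)) (fun s => lsum us (fun u => g' u s)).
Proof.
  induction us as [|u us IH]; simpl; intros H.
  - intros x _. apply @is_derive_const.
  - apply deriv_on_plus; auto.
Qed.

Lemma smooth_lsum (n : nat) (us : list R) (g : R -> R -> R) :
  (forall u, In u us -> smooth lo hi n (g u)) ->
  smooth lo hi n (fun s => lsum us (fun u => g u s)).
Proof.
  induction us as [|u us IH]; simpl; intros H.
  - apply smooth_const.
  - apply smooth_plus; auto.
Qed.

(** Each u costs d + 1 derivations, the number of coefficients of its polynomial. The exponent and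
    the polynomials are quantified inside the induction on [us] because the derivations that remove
    [u1] alter both. *)
Lemma forced_zero_homogeneous (d : nat) (us : list R) :
  (forall u, In u us -> hi <= u ^ 2) ->
  forall (del : R) (ps : R -> R -> R), (forall u, is_poly (S d) (ps u)) ->
  forced_zero lo hi (length us * S d)
    (fun s => lsum us (fun u => ps u s * Rpower (u ^ 2 - s) (- del))).
Proof.
  induction us as [|u1 us IH]; intros Hus del0 ps0 Hps0.
  { intros _ x _. reflexivity. }
  assert (H1 : hi <= u1 ^ 2) by (apply Hus; simpl; auto).
  assert (Hus' : forall u, In u us -> hi <= u ^ 2) by (intros; apply Hus; simpl; auto).
  (* Here j counts the coefficients left in the [u1] term, a polynomial of degree below j in 1 /
     (u1^2 - s). The relation gam - del = - d is the homogeneity: a derivation raises [gam] and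
     [del] by 1 each and so preserves it. *)
  assert (aux : forall j q ps gam del, (j <= S d)%nat -> is_poly j q ->
     (forall u, is_poly (S d) (ps u)) -> gam - del = - INR d ->
     forced_zero lo hi (j + length us * S d)
       (fun s => q s * Rpower (u1 ^ 2 - s) (1 - INR j)
          + lsum us (fun u => ps u s *
              (Rpower (u1 ^ 2 - s) gam * Rpower (u ^ 2 - s) (- del))))).
  { induction j as [|j IHj]; intros q ps gam del Hj Hq Hps Hgd.
    (* The [u1] term is gone; cancelling the common power of u1^2 - s leaves a sum over [us], to
       which the outer induction hypothesis applies. *)
    - apply forced_zero_factor with (fun s => Rpower (u1 ^ 2 - s) (- gam)).
      { intros; apply smooth_Rpower; auto. }
      { intros; apply Rpower_nonzero. }
      apply forced_zero_ext with
        (fun s => lsum us (fun u => ps u s * Rpower (u ^ 2 - s) (- del)));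
        [|apply IH; auto].
      intros s Hs. simpl in Hq. rewrite Hq, Rmult_0_l, Rplus_0_l, lsum_scal.
      apply lsum_ext. intros u _.
      transitivity (ps u s * Rpower (u ^ 2 - s) (- del) *
        (Rpower (u1 ^ 2 - s) (- gam) * Rpower (u1 ^ 2 - s) gam)); [ring|].
      rewrite <- Rpower_plus, Rplus_opp_l, Rpower_O by lra. ring.
    - simpl Nat.add.
      (* [f'] is the derivative as the product rule gives it. In [g] the powers are regrouped so
         that the shape of [aux] returns, with j in place of S j and with gam + 1, del + 1. *)
      apply forced_zero_deriv with (w := fun s => Rpower (u1 ^ 2 - s) 2)
        (f' := fun s =>
          (Derive q s * Rpower (u1 ^ 2 - s) (1 - INR (S j))
           + q s * (- (1 - INR (S j)) * Rpower (u1 ^ 2 - s) (1 - INR (S j) - 1)))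
          + lsum us (fun u =>
              Derive (ps u) s * (Rpower (u1 ^ 2 - s) gam * Rpower (u ^ 2 - s) (- del))
              + ps u s * (- gam * Rpower (u1 ^ 2 - s) (gam - 1) * Rpower (u ^ 2 - s) (- del)
                 + Rpower (u1 ^ 2 - s) gam * (- - del * Rpower (u ^ 2 - s) (- del - 1)))))
        (g := fun s =>
          ((u1 ^ 2 - s) * Derive q s + INR j * q s) * Rpower (u1 ^ 2 - s) (1 - INR j)
          + lsum us (fun u =>
             ((u1 ^ 2 - s) * ((u ^ 2 - s) * Derive (ps u) s)
               + (- gam) * ((u ^ 2 - s) * ps u s) + del * ((u1 ^ 2 - s) * ps u s))
             * (Rpower (u1 ^ 2 - s) (gam + 1) * Rpower (u ^ 2 - s) (- (del + 1))))).
      + apply smooth_plus; [|apply smooth_lsum; intros u Hu];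
          repeat apply smooth_mult;
          solve [eapply smooth_poly; eauto | apply smooth_Rpower; auto].
      + apply deriv_on_plus.
        * apply deriv_on_mult; [eapply deriv_on_poly; eauto | apply deriv_on_Rpower; auto].
        * apply deriv_on_lsum. intros u Hu.
          apply deriv_on_mult; [eapply deriv_on_poly; eauto|].
          apply deriv_on_mult; apply deriv_on_Rpower; auto.
      + intros; apply smooth_Rpower; auto.
      + intros; apply Rpower_nonzero.
      + intros s Hs. cbv beta.
        assert (X0 : 0 < u1 ^ 2 - s) by lra.
        rewrite (Rmult_plus_distr_l (Rpower (u1 ^ 2 - s) 2)). f_equal.
        * rewrite S_INR.
          (* Every exponent is written as the smallest one plus units; [Rpower_succ] then leaves a
             single power as an atom for [ring]. *)
          replace (1 - (INR j + 1)) with (- INR j - 1 + 1) by ring.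
          replace (- INR j - 1 + 1 - 1) with (- INR j - 1) by ring.
          replace (1 - INR j) with (- INR j - 1 + 1 + 1) by ring.
          replace 2 with (0 + 1 + 1) by ring.
          rewrite !Rpower_succ, Rpower_O by auto. ring.
        * rewrite lsum_scal. apply lsum_ext. intros u Hu.
          assert (Y0 : 0 < u ^ 2 - s) by (specialize (Hus' u Hu); lra).
          replace (- (del + 1)) with (- del - 1) by ring.
          replace (gam + 1) with (gam - 1 + 1 + 1) by ring.
          replace (Rpower (u1 ^ 2 - s) gam) with (Rpower (u1 ^ 2 - s) (gam - 1 + 1))
            by (f_equal; ring).
          replace (Rpower (u ^ 2 - s) (- del)) with (Rpower (u ^ 2 - s) (- del - 1 + 1))
            by (f_equal; ring).
          replace 2 with (0 + 1 + 1) by ring.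
          rewrite !Rpower_succ, Rpower_O by auto. ring.
      + apply IHj; auto; [lia| |intros u|lra].
        * apply is_poly_drop; auto.
        * apply is_poly_stay; auto. }
  (* This factor turns the exponent - del0 of the [u1] term into - d, the entry point j = d + 1 of
     [aux], and sets gam = del0 - d. *)
  apply forced_zero_factor with (fun s => Rpower (u1 ^ 2 - s) (del0 - INR d)).
  { intros; apply smooth_Rpower; auto. }
  { intros; apply Rpower_nonzero. }
  apply forced_zero_ext with (fun s =>
    ps0 u1 s * Rpower (u1 ^ 2 - s) (1 - INR (S d))
    + lsum us (fun u => ps0 u s *
        (Rpower (u1 ^ 2 - s) (del0 - INR d) * Rpower (u ^ 2 - s) (- del0)))).
  - intros s Hs. rewrite lsum_cons, Rmult_plus_distr_l. f_equal.
    + rewrite S_INR. replace (1 - (INR d + 1)) with (del0 - INR d + - del0) by ring.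
      rewrite Rpower_plus. ring.
    + rewrite lsum_scal. apply lsum_ext. intros; ring.
  - apply aux; auto. ring.
Qed.

(** k plain derivations remove p. Each raises [del] by 1 and keeps the degrees of the other
    polynomials, so what remains is homogeneous. The total is the number of coefficients. *)
Lemma forced_zero_root_sum (d : nat) (us : list R) :
  (forall u, In u us -> hi <= u ^ 2) ->
  forall (k : nat) (p : R -> R) (del : R) (ps : R -> R -> R),
  is_poly k p -> (forall u, is_poly (S d) (ps u)) ->
  forced_zero lo hi (k + length us * S d)
    (fun s => p s + lsum us (fun u => ps u s * Rpower (u ^ 2 - s) (- del))).
Proof.
  intros Hus. induction k as [|k IH]; intros p del ps Hp Hps.
  - apply forced_zero_ext with (2 := forced_zero_homogeneous d us Hus del ps Hps).
    intros s _. rewrite Hp. ring.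
  - simpl Nat.add.
    apply forced_zero_deriv with (w := fun _ => 1)
      (f' := fun s => Derive p s + lsum us (fun u =>
         Derive (ps u) s * Rpower (u ^ 2 - s) (- del)
         + ps u s * (- - del * Rpower (u ^ 2 - s) (- del - 1))))
      (g := fun s => Derive p s + lsum us (fun u =>
         ((u ^ 2 - s) * Derive (ps u) s + del * ps u s) * Rpower (u ^ 2 - s) (- (del + 1)))).
    + apply smooth_plus; [eapply smooth_poly; eauto|].
      apply smooth_lsum. intros u Hu. apply smooth_mult;
        [eapply smooth_poly; eauto | apply smooth_Rpower; auto].
    + apply deriv_on_plus; [eapply deriv_on_poly; eauto|].
      apply deriv_on_lsum. intros u Hu. apply deriv_on_mult;
        [eapply deriv_on_poly; eauto | apply deriv_on_Rpower; auto].
    + intros; apply smooth_const.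
    + intros; lra.
    + intros s Hs. rewrite Rmult_1_l. f_equal. apply lsum_ext. intros u Hu.
      assert (Y0 : 0 < u ^ 2 - s) by (specialize (Hus u Hu); lra).
      replace (- (del + 1)) with (- del - 1) by ring.
      replace (Rpower (u ^ 2 - s) (- del)) with (Rpower (u ^ 2 - s) (- del - 1 + 1))
        by (f_equal; ring).
      rewrite Rpower_succ by auto. ring.
    + apply IH.
      * apply (is_poly_derive (S k) p Hp).
      * intros u. apply is_poly_plus; [apply is_poly_derive_sub | apply is_poly_scal]; auto.
Qed.

End Chebyshev.

(** * The substitution s = r^2 *)

Lemma smooth_inv (lo hi : R) (n : nat) : forall g,
  (forall x, lo < x < hi -> g x <> 0) -> smooth lo hi n g ->
  smooth lo hi n (fun x => / g x).
Proof.
  induction n as [|n IH]; intros g Ng Sg; [exact I|].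
  assert (Si := IH g Ng (smooth_pred _ _ _ _ Sg)).
  destruct Sg as (g' & D & Sg).
  exists (fun x => (-1) * (g' x * (/ g x * / g x))). split.
  - intros x Hx.
    replace (-1 * (g' x * (/ g x * / g x))) with (- g' x / g x ^ 2)
      by (field; auto).
    apply is_derive_inv; auto.
  - repeat apply smooth_mult; auto using smooth_const.
Qed.

Lemma smooth_prod_lin (lo hi : R) (n : nat) (l : list R) :
  smooth lo hi n (prod_lin l).
Proof.
  induction l as [|v l IH].
  - exact (smooth_const lo hi n 1).
  - apply (smooth_mult lo hi n (fun t => t - v) (prod_lin l)); auto.
    apply (smooth_plus lo hi n (fun t => t) (fun _ => - v));
      auto using smooth_id, smooth_const.
Qed.

Lemma prod_lin_nonzero (l : list R) (t : R) :
  (forall v, In v l -> t <> v) -> prod_lin l t <> 0.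
Proof.
  induction l as [|v l IH]; simpl; intros H; [lra|].
  apply Rmult_integral_contrapositive. split; [|apply IH; auto].
  apply Rminus_eq_contra. auto.
Qed.

Lemma square_between (rho r : R) : 0 < r < rho -> 0 < r ^ 2 < rho ^ 2.
Proof. intros H. split; nra. Qed.

Lemma deriv_on_square (rho : R) (f f' : R -> R) :
  deriv_on 0 (rho ^ 2) f f' ->
  deriv_on 0 rho (fun r => f (r ^ 2)) (fun r => 2 * r * f' (r ^ 2)).
Proof.
  intros D r Hr. apply (is_derive_comp f (fun r => r ^ 2)).
  - apply D, square_between, Hr.
  - auto_derive; auto; ring.
Qed.

Lemma smooth_square (rho : R) (n : nat) : forall f,
  smooth 0 (rho ^ 2) n f -> smooth 0 rho n (fun r => f (r ^ 2)).
Proof.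
  induction n as [|n IH]; intros f H; [exact I|].
  destruct H as (f' & D & S). exists (fun r => 2 * r * f' (r ^ 2)).
  split; [apply deriv_on_square, D|].
  repeat apply smooth_mult; auto using smooth_const, smooth_id.
Qed.

(** The derivative of f(r^2) is 2 r f'(r^2), and 2 r is invertible on (0, rho), so the substitution
    preserves orders of vanishing. *)
Lemma vanishes_square (rho : R) (m : nat) : forall f r, 0 < r < rho ->
  smooth 0 (rho ^ 2) m f -> vanishes 0 rho m (fun r => f (r ^ 2)) r ->
  vanishes 0 (rho ^ 2) m f (r ^ 2).
Proof.
  induction m as [|m IH]; intros f r Hr Sf V; [exact I|].
  destruct Sf as (f' & D & Sf), V as (Z & g & Dg & V).
  split; auto. exists f'. split; auto. apply IH; auto.
  apply vanishes_ext with (fun r => / (2 * r) * g r); auto.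
  - intros x Hx.
    rewrite (deriv_on_unique _ _ _ _ _ Dg (deriv_on_square rho f f' D) x Hx).
    field. lra.
  - apply vanishes_mult; auto. apply smooth_inv; [intros; lra|].
    apply smooth_mult; auto using smooth_const, smooth_id.
Qed.

(** In the variable s, J becomes F divided by [prod_lin vs], which has no zeros on (0, rho^2). Zeros
    of J thus become zeros of F of at least the same multiplicity, and too many of them would make
    F, hence J, identically zero. *)
Lemma zero_count (rho : R) (vs us : list R) (J : R -> R)
    (k d : nat) (p : R -> R) (ps : R -> R -> R) (e : R) :
  (forall v, In v vs -> rho ^ 2 <= v) ->
  (forall u, In u us -> rho ^ 2 <= u ^ 2) ->
  is_poly k p -> (forall u, is_poly (S d) (ps u)) ->
  (forall r, 0 < r < rho -> prod_lin vs (r ^ 2) * J r =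
     p (r ^ 2) + lsum us (fun u => ps u (r ^ 2) * Rpower (u ^ 2 - r ^ 2) (- e))) ->
  (exists r, 0 < r < rho /\ J r <> 0) ->
  forall zs : list (R * nat), NoDup (map fst zs) ->
  (forall z, In z zs -> 0 < fst z < rho /\
     forall m, (m < snd z)%nat -> Derive_n J m (fst z) = 0) ->
  (sum_mult zs < k + length us * S d)%nat.
Proof.
  intros Hvs Hus Hp Hps E (r0 & Hr0 & N0) zs Hd Hz.
  set (F := fun s => p s + lsum us (fun u => ps u s * Rpower (u ^ 2 - s) (- e))).
  assert (ND : forall s, 0 < s < rho ^ 2 -> prod_lin vs s <> 0).
  { intros s Hs. apply prod_lin_nonzero. intros v Hv. specialize (Hvs v Hv). lra. }
  assert (SF : forall n, smooth 0 (rho ^ 2) n F).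
  { intros n. apply smooth_plus; [eapply smooth_poly; eauto|].
    apply smooth_lsum. intros u Hu. apply smooth_mult;
      [eapply smooth_poly; eauto | apply smooth_Rpower; auto]. }
  set (f := fun s => / prod_lin vs s * F s).
  assert (Sf : forall n, smooth 0 (rho ^ 2) n f).
  { intros n. apply smooth_mult; auto. apply smooth_inv; auto using smooth_prod_lin. }
  assert (Ef : forall r, 0 < r < rho -> f (r ^ 2) = J r).
  { intros r Hr. unfold f, F. rewrite <- E by auto. field.
    apply ND, square_between, Hr. }
  destruct (Nat.lt_ge_cases (sum_mult zs) (k + length us * S d)) as [|Hge]; auto.
  exfalso. apply N0. rewrite <- Ef by auto. unfold f.
  assert (T : forced_zero 0 (rho ^ 2) (k + length us * S d) F)
    by (apply forced_zero_root_sum; auto).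
  rewrite T; [ring| |apply square_between, Hr0].
  (* Squaring keeps the positions distinct because they are positive. *)
  destruct (sort_zeros 0 (rho ^ 2) F (map (fun z => (fst z ^ 2, snd z)) zs))
    as (zs' & S' & M').
  - clear - Hd Hz. induction zs as [|z zs IH]; simpl; [constructor|].
    simpl in Hd. inversion Hd as [|? ? Hn Hd']; subst.
    constructor; [|apply IH; auto; intros; apply Hz; simpl; auto].
    rewrite map_map, in_map_iff. simpl. intros (y & Ey & Hy). apply Hn.
    apply in_map_iff. exists y. split; auto.
    destruct (Hz z) as (Bz & _); [simpl; auto|].
    destruct (Hz y) as (By & _); [simpl; auto|]. nra.
  - intros z' Hz'. apply in_map_iff in Hz'. destruct Hz' as (z & <- & Iz).
    destruct (Hz z Iz) as (B & V). simpl fst; simpl snd.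
    split; [apply square_between, B|].
    apply vanishes_ext with (fun s => prod_lin vs s * f s).
    + apply square_between, B.
    + intros s Hs. unfold f. field. auto.
    + apply vanishes_mult; auto using smooth_prod_lin.
      apply vanishes_square; auto.
      apply vanishes_Derive_n; auto using smooth_square.
      (* J is known to agree with f(r^2) only on (0, rho), which is a neighbourhood of the zero. *)
      intros m Hm. rewrite <- (V m Hm). apply Derive_n_ext_loc.
      apply (locally_between 0 rho); auto.
  - exists zs'. split; auto. rewrite M'.
    replace (sum_mult (map (fun z => (fst z ^ 2, snd z)) zs)) with (sum_mult zs); auto.
    unfold sum_mult. clear. induction zs as [|z zs IH]; simpl; auto.
Qed.

(** * Integrals over the circle *)

Lemma lsum_single (us : list R) (u0 c : R) (h : R -> R) :
  NoDup us -> In u0 us ->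
  lsum us (fun u => (if Req_dec_T u u0 then c else 0) * h u) = c * h u0.
Proof.
  assert (Z : forall us, ~ In u0 us ->
    lsum us (fun u => (if Req_dec_T u u0 then c else 0) * h u) = 0).
  { induction us0 as [|u us0 IH]; auto. intros H. rewrite lsum_cons, IH.
    - destruct Req_dec_T as [->|]; [|ring]. destruct H; simpl; auto.
    - intro K. apply H. simpl; auto. }
  induction us as [|u us IH]; [intros _ []|].
  intros Hd Hi. inversion Hd; subst. rewrite lsum_cons.
  destruct Req_dec_T as [->|N].
  - rewrite Z by auto. ring.
  - rewrite IH; auto; [ring|]. destruct Hi; [congruence|auto].
Qed.

Lemma RInt_derive_R (F f : R -> R) (a b : R) :
  (forall t, is_derive F t (f t)) -> (forall t, continuous f t) ->
  (RInt f a b : R) = F b - F a.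
Proof.
  intros D K. apply is_RInt_unique.
  exact (is_RInt_derive F f a b (fun t _ => D t) (fun t _ => K t)).
Qed.

Lemma ex_RInt_cont (f : R -> R) (a b : R) :
  (forall t, continuous f t) -> ex_RInt f a b.
Proof. intros K. apply @ex_RInt_continuous. auto. Qed.

Lemma RInt_plus_R (f g : R -> R) (a b : R) :
  (forall t, continuous f t) -> (forall t, continuous g t) ->
  (RInt (fun t => f t + g t) a b : R) = RInt f a b + RInt g a b.
Proof. intros Kf Kg. apply @RInt_plus; apply ex_RInt_cont; auto. Qed.

Lemma RInt_scal_R (f : R -> R) (c a b : R) :
  (forall t, continuous f t) ->
  (RInt (fun t => c * f t) a b : R) = c * RInt f a b.
Proof. intros Kf. apply @RInt_scal; apply ex_RInt_cont; auto. Qed.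

(** * Integrands whose integrals fall under the Chebyshev bound *)

Section IntegralClass.

Variables (rho : R) (us : list R).

(** The right-hand side is that of [zero_count] at exponent 1/2; k0 and k track the coefficient
    counts on which the final bound depends. Continuity is carried along because linearity of [RInt]
    needs integrability. *)
Definition integral_class (k0 k : nat) (g : R -> R -> R) : Prop :=
  (forall r, 0 < r < rho -> forall t, continuous (g r) t) /\
  exists p ps, is_poly k0 p /\ (forall u, is_poly k (ps u)) /\
    forall r, 0 < r < rho -> (RInt (g r) 0 (2 * PI) : R) =
      p (r ^ 2) + lsum us (fun u => ps u (r ^ 2) * Rpower (u ^ 2 - r ^ 2) (- (1 / 2))).

Lemma class_ext (k0 k : nat) (g h : R -> R -> R) :
  (forall r t, 0 < r < rho -> g r t = h r t) ->
  integral_class k0 k g -> integral_class k0 k h.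
Proof.
  intros E (K & p & ps & Hp & Hps & H). split.
  - intros r Hr t. apply continuous_ext with (g r); auto.
  - exists p, ps. repeat split; auto. intros r Hr. rewrite <- H by auto.
    apply RInt_ext. intros; symmetry; auto.
Qed.

Lemma class_le (k0 k k0' k' : nat) (g : R -> R -> R) :
  (k0 <= k0')%nat -> (k <= k')%nat ->
  integral_class k0 k g -> integral_class k0' k' g.
Proof.
  intros H0 H1 (K & p & ps & Hp & Hps & H). split; auto.
  exists p, ps. repeat split; auto.
  - apply is_poly_le with k0; auto.
  - intros u. apply is_poly_le with k; auto.
Qed.

Lemma class_plus (k0 k : nat) (g h : R -> R -> R) :
  integral_class k0 k g -> integral_class k0 k h ->
  integral_class k0 k (fun r t => g r t + h r t).
Proof.
  intros (K & p & ps & Hp & Hps & H) (K' & q & qs & Hq & Hqs & H'). split.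
  - intros r Hr t. apply (continuous_plus (g r) (h r)); auto.
  - exists (fun s => p s + q s), (fun u s => ps u s + qs u s).
    repeat split; auto using is_poly_plus.
    intros r Hr. rewrite RInt_plus_R, H, H' by auto.
    transitivity (p (r ^ 2) + q (r ^ 2) +
      (lsum us (fun u => ps u (r ^ 2) * Rpower (u ^ 2 - r ^ 2) (- (1 / 2)))
       + lsum us (fun u => qs u (r ^ 2) * Rpower (u ^ 2 - r ^ 2) (- (1 / 2)))));
      [ring|].
    rewrite lsum_plus. f_equal. apply lsum_ext. intros; ring.
Qed.

Lemma class_scal_fun (k0 k k0' k' : nat) (m : R -> R) (g : R -> R -> R) :
  (forall p, is_poly k0 p -> is_poly k0' (fun s => m s * p s)) ->
  (forall p, is_poly k p -> is_poly k' (fun s => m s * p s)) ->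
  integral_class k0 k g -> integral_class k0' k' (fun r t => m (r ^ 2) * g r t).
Proof.
  intros M0 M1 (K & p & ps & Hp & Hps & H). split.
  - intros r Hr t. apply (continuous_scal_r (m (r ^ 2)) (g r)); auto.
  - exists (fun s => m s * p s), (fun u s => m s * ps u s). repeat split; auto.
    intros r Hr. rewrite RInt_scal_R, H, Rmult_plus_distr_l, lsum_scal by auto.
    f_equal. apply lsum_ext. intros; ring.
Qed.

Lemma class_scal (k0 k : nat) (c : R) (g : R -> R -> R) :
  integral_class k0 k g -> integral_class k0 k (fun r t => c * g r t).
Proof. apply (class_scal_fun k0 k k0 k (fun _ => c)); intros; apply is_poly_scal; auto. Qed.

Lemma class_minus (k0 k : nat) (g h : R -> R -> R) :
  integral_class k0 k g -> integral_class k0 k h ->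
  integral_class k0 k (fun r t => g r t - h r t).
Proof.
  intros Hg Hh. apply class_ext with (fun r t => g r t + (-1) * h r t).
  - intros; ring.
  - apply class_plus; auto using class_scal.
Qed.

Lemma class_sub_square (k0 k : nat) (v : R) (g : R -> R -> R) :
  integral_class k0 k g -> integral_class (S k0) (S k) (fun r t => (v - r ^ 2) * g r t).
Proof.
  apply (class_scal_fun k0 k (S k0) (S k) (fun s => v - s));
    intros; apply is_poly_mult_sub; auto.
Qed.

Lemma class_prod_lin (k0 k : nat) (vs : list R) (g : R -> R -> R) :
  integral_class k0 k g ->
  integral_class (k0 + length vs) (k + length vs)
    (fun r t => prod_lin vs (r ^ 2) * g r t).
Proof.
  intros H. induction vs as [|v vs IH]; simpl length.
  - rewrite !Nat.add_0_r. apply class_ext with g; auto. intros; simpl; ring.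
  - rewrite !Nat.add_succ_r.
    apply class_ext with (fun r t =>
      (-1) * ((v - r ^ 2) * (prod_lin vs (r ^ 2) * g r t))).
    + intros. simpl prod_lin. ring.
    + apply class_scal, class_sub_square, IH.
Qed.

Lemma class_sum (k0 k : nat) (g : nat -> R -> R -> R) (n : nat) :
  (forall i, (i <= n)%nat -> integral_class k0 k (g i)) ->
  integral_class k0 k (fun r t => sum_f_R0 (fun i => g i r t) n).
Proof.
  induction n as [|n IH]; simpl; intros H; auto.
  apply class_plus; auto.
Qed.

Hypothesis us_NoDup : NoDup us.
Hypothesis us_large : forall u, In u us -> rho <= u.

(** * Monomials over one linear factor, up to a rotation of the circle *)

Section Rotation.

(** Both (cos, sin) and (sin, - cos) satisfy the hypotheses below, so one computation serves the
    denominators x - a and y - b. *)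
Variables co si : R -> R.
Hypothesis co_derive : forall t, is_derive co t (- si t).
Hypothesis si_derive : forall t, is_derive si t (co t).
Hypothesis circle : forall t, si t ^ 2 + co t ^ 2 = 1.
Hypothesis co_antiperiodic : forall t, co (t + PI) = - co t.
Hypothesis si_antiperiodic : forall t, si (t + PI) = - si t.

Lemma co_periodic : co (2 * PI) = co 0.
Proof.
  replace (2 * PI) with (0 + PI + PI) by ring.
  rewrite !co_antiperiodic. ring.
Qed.

Lemma si_periodic : si (2 * PI) = si 0.
Proof.
  replace (2 * PI) with (0 + PI + PI) by ring.
  rewrite !si_antiperiodic. ring.
Qed.

Lemma continuous_monomial (i j : nat) (t : R) :
  continuous (fun t => si t ^ i * co t ^ j) t.
Proof.
  apply @ex_derive_continuous. auto_derive.
  repeat split; eexists; eauto.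
Qed.

(** A half turn changes the sign of an odd monomial, so the two halves of the circle cancel. *)
Lemma RInt_monomial_odd (i j : nat) : Nat.Odd (i + j) ->
  (RInt (fun t => si t ^ i * co t ^ j) 0 (2 * PI) : R) = 0.
Proof.
  intros [h Hh]. set (f := fun t => si t ^ i * co t ^ j).
  assert (K : forall t, continuous f t) by (intros; apply continuous_monomial).
  assert (E1 : RInt f 0 PI + RInt f PI (2 * PI) = RInt f 0 (2 * PI))
    by (apply @RInt_Chasles; apply ex_RInt_cont; auto).
  assert (E2 : RInt (fun t => 1 * f (1 * t + PI)) 0 PI
               = RInt f (1 * 0 + PI) (1 * PI + PI))
    by (apply (RInt_comp_lin f); apply ex_RInt_cont; auto).
  replace (1 * 0 + PI) with PI in E2 by ring.
  replace (1 * PI + PI) with (2 * PI) in E2 by ring.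
  assert (E3 : forall t, 1 * f (1 * t + PI) = (-1) * f t).
  { intros t. unfold f. rewrite Rmult_1_l, (Rmult_1_l t).
    rewrite si_antiperiodic, co_antiperiodic.
    replace (- si t) with ((-1) * si t) by ring.
    replace (- co t) with ((-1) * co t) by ring.
    rewrite !Rpow_mult_distr.
    transitivity ((-1) ^ i * (-1) ^ j * (si t ^ i * co t ^ j)); [ring|].
    rewrite <- pow_add, Hh, Nat.add_1_r, pow_1_odd. reflexivity. }
  rewrite (RInt_ext _ _ _ _ (fun t _ => E3 t)), RInt_scal_R in E2 by auto.
  lra.
Qed.

(** By homogeneity the integral is a constant times r^(i + j): a power of r^2 when i + j is even,
    and 0 when it is odd. No root terms occur, hence the arbitrary k. *)
Lemma class_monomial (i j k0 k : nat) : ((i + j) / 2 < k0)%nat ->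
  integral_class k0 k (fun r t => (r * si t) ^ i * (r * co t) ^ j).
Proof.
  intros Hk. set (m := RInt (fun t => si t ^ i * co t ^ j) 0 (2 * PI)).
  assert (E : forall r t, (r * si t) ^ i * (r * co t) ^ j
              = r ^ (i + j) * (si t ^ i * co t ^ j)).
  { intros. rewrite !Rpow_mult_distr, pow_add. ring. }
  split.
  - intros r _ t. apply continuous_ext with (fun t => r ^ (i + j) * (si t ^ i * co t ^ j)).
    + intros; symmetry; apply E.
    + apply (continuous_scal_r (r ^ (i + j)) (fun t => si t ^ i * co t ^ j)).
      apply continuous_monomial.
  - exists (fun s => m * s ^ ((i + j) / 2)), (fun _ _ => 0).
    repeat split; auto using is_poly_monomial, is_poly_0.
    intros r _. rewrite (RInt_ext _ _ _ _ (fun t _ => E r t)).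
    rewrite RInt_scal_R by apply continuous_monomial. fold m.
    rewrite <- (lsum_scal us 0 (fun u => Rpower _ _)).
    destruct (Nat.Even_or_Odd (i + j)) as [[h Hh]|Ho].
    + rewrite Hh, (Nat.mul_comm 2 h), Nat.div_mul, Nat.mul_comm, pow_mult by lia. ring.
    + unfold m. rewrite RInt_monomial_odd by auto. ring.
Qed.

Lemma co_bound (t : R) : -1 <= co t <= 1.
Proof. specialize (circle t). split; nra. Qed.

Lemma denominator_nonzero (b r t : R) :
  In (Rabs b) us -> 0 < r < rho -> r * co t - b <> 0.
Proof.
  intros Hb Hr E. apply us_large in Hb. destruct (co_bound t).
  unfold Rabs in Hb. destruct Rcase_abs; nra.
Qed.

(* [q] is the square root of [a^2 - r^2] carrying the sign of [a]; the
   antiderivative comes from the Poisson kernel with parameter [bet]. *)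
Lemma RInt_inv_sub (a r q : R) :
  0 < r -> q ^ 2 = a ^ 2 - r ^ 2 -> 0 < q * a ->
  (forall t, r * co t - a <> 0) ->
  (RInt (fun t => / (r * co t - a)) 0 (2 * PI) : R) = - (2 * PI) / q.
Proof.
  intros Hr Hq Hs Nz.
  assert (q0 : q <> 0) by nra.
  (* The root of r z^2 - 2 a z + r = 0 inside the unit disc. This makes 1 - 2 bet co t + bet^2
     proportional to a - r co t, the fact recorded in [Key]. *)
  set (bet := (a - q) / r).
  assert (Eb : r * bet = a - q) by (unfold bet; field; lra).
  (* With r^2 = a^2 - q^2 the claim amounts to q^2 < q a, proved by comparing squares: (q a)^2 = q^2
     (q^2 + r^2). *)
  assert (Hb : bet ^ 2 < 1).
  { assert (r ^ 2 * bet ^ 2 < r ^ 2 * 1).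
    { replace (r ^ 2 * bet ^ 2) with ((r * bet) ^ 2) by ring. rewrite Eb.
      assert (q ^ 2 < q * a); [|nra].
      assert (Ha : (q * a) ^ 2 > (q ^ 2) ^ 2).
      { replace ((q * a) ^ 2) with (q ^ 2 * (q ^ 2 + r ^ 2)) by (rewrite Rpow_mult_distr; replace (a ^ 2) with (q ^ 2 + r ^ 2) by lra; ring).
        assert (0 < q ^ 2) by nra. assert (0 < r ^ 2) by nra. nra. }
      nra. }
    nra. }
  assert (Nd : forall t, 1 - bet * co t <> 0).
  { intros t E0. assert (E1 : (bet * co t) ^ 2 = 1).
    { replace (bet * co t) with 1 by lra. ring. }
    rewrite Rpow_mult_distr in E1.
    assert (co t ^ 2 <= 1) by (specialize (circle t); nra).
    assert (bet ^ 2 * co t ^ 2 <= bet ^ 2 * 1)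
      by (apply Rmult_le_compat_l; [apply pow2_ge_0 | auto]). lra. }
  (* The arctangent is minus the argument of 1 - bet (co t + i si t), and the bracket has the
     Poisson kernel (1 - bet^2) / (1 - 2 bet co t + bet^2) as derivative. The arctangent is
     periodic, so only the linear term t contributes to the integral. *)
  rewrite (RInt_derive_R
    (fun t => (- / q) * (t + 2 * atan (bet * si t / (1 - bet * co t))))).
  - rewrite co_periodic, si_periodic. field. auto.
  - intros t. specialize (Nd t). specialize (Nz t).
    assert (Dq : is_derive (fun t => bet * si t / (1 - bet * co t)) t
       ((bet * co t * (1 - bet * co t) - bet * si t * (bet * si t)) / (1 - bet * co t) ^ 2)).
    { replace (bet * co t * (1 - bet * co t) - bet * si t * (bet * si t))
        with (bet * co t * (1 - bet * co t) - (bet * si t) * (- (bet * (- si t)))) by ring.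
      apply (is_derive_div (fun t => bet * si t) (fun t => 1 - bet * co t) t
        (bet * co t) (- (bet * (- si t)))); auto.
      - exact (is_derive_scal si t bet (co t) (si_derive t)).
      - auto_derive; [eexists; eauto|].
        replace (Derive (fun x => co x) t) with (- si t)
          by (symmetry; apply is_derive_unique, co_derive). ring. }
    assert (Da := is_derive_comp atan _ t _ _ (is_derive_atan _) Dq).
    set (l := scal _ _) in Da.
    replace (/ (r * co t - a)) with ((- / q) * (1 + 2 * l)).
    + apply (is_derive_scal (fun t => t + 2 * atan (bet * si t / (1 - bet * co t))) t).
      apply (is_derive_Rplus (fun t => t)); [apply @is_derive_id|].
      apply (is_derive_scal (fun t => atan (bet * si t / (1 - bet * co t))) t). exact Da.
    + unfold l, scal; simpl; unfold mult; simpl. unfold Rsqr.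
      assert (Hd : 1 - 2 * bet * co t + bet ^ 2 = (1 - bet * co t) ^ 2 + (bet * si t) ^ 2).
      { replace ((bet * si t) ^ 2) with (bet ^ 2 * (1 - co t ^ 2))
          by (rewrite <- (circle t); ring). ring. }
      assert (Hdp : 0 < (1 - bet * co t) ^ 2 + (bet * si t) ^ 2) by nra.
      assert (Key : q * (1 - 2 * bet * co t + bet ^ 2) = (1 - bet ^ 2) * (a - r * co t)).
      { apply Rmult_eq_reg_l with (r ^ 2); [|nra].
        transitivity (q * (r ^ 2 - 2 * r * (r * bet) * co t + (r * bet) ^ 2)); [ring|].
        transitivity ((r ^ 2 - (r * bet) ^ 2) * (a - r * co t)); [|ring].
        rewrite Eb. replace (r ^ 2) with (a ^ 2 - q ^ 2) by (rewrite Hq; ring). ring. }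
      set (D := (1 - bet * co t) ^ 2 + (bet * si t) ^ 2) in *.
      set (N := bet * co t * (1 - bet * co t) - bet * si t * (bet * si t)).
      assert (El : N / (1 - bet * co t) ^ 2 *
          / (1 + bet * si t / (1 - bet * co t) * (bet * si t / (1 - bet * co t))) = N / D).
      { unfold D. field. repeat split; auto. fold D. lra. }
      simpl in El. rewrite El.
      assert (EN : D + 2 * N = 1 - bet ^ 2).
      { unfold N. rewrite <- Hd.
        replace (bet * si t * (bet * si t)) with (bet ^ 2 * (1 - co t ^ 2))
          by (rewrite <- (circle t); ring). ring. }
      replace (- / q * (1 + 2 * (N / D))) with (- (D + 2 * N) / (q * D)) by (field; lra).
      rewrite Hd in Key. rewrite EN, Key.
      assert (1 - bet ^ 2 <> 0) by lra. field.
      repeat split; auto. intro E0. apply Nz. lra.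
  - intros t. apply @ex_derive_continuous. auto_derive.
    split; [exists (- si t); apply co_derive|]. split; [apply Nz | exact I].
Qed.

(** The sign of a goes into the constant coefficient of the root term, so a and - a share the term
    of u = |a|. This is why only distinct absolute values enter the bound. *)
Lemma class_inv_sub (a : R) : In (Rabs a) us ->
  integral_class 0 1 (fun r t => / (r * co t - a)).
Proof.
  intros Ha. split.
  - intros r Hr t. apply @ex_derive_continuous. auto_derive.
    split; [exists (- si t); apply co_derive|].
    split; [apply (denominator_nonzero a r t Ha Hr) | exact I].
  - set (sg := if Rle_dec 0 a then 1 else -1).
    exists (fun _ => 0), (fun u _ => if Req_dec_T u (Rabs a) then - (2 * PI) * sg else 0).
    split; [apply (is_poly_0 0)|]. split.
    { intros u. exists (fun _ => 0), (if Req_dec_T u (Rabs a) then - (2 * PI) * sg else 0).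
      split; [apply (is_poly_0 0)|]. intros; simpl; ring. }
    intros r Hr. assert (Hra := us_large _ Ha).
    rewrite (lsum_single us (Rabs a) _
      (fun u => Rpower (u ^ 2 - r ^ 2) (- (1 / 2)))) by auto.
    rewrite pow2_abs.
    assert (Hpos : 0 < a ^ 2 - r ^ 2) by (rewrite <- (pow2_abs a); nra).
    assert (Hsq : 0 < sqrt (a ^ 2 - r ^ 2)) by (apply sqrt_lt_R0; auto).
    assert (Hsg : sg * sg = 1) by (unfold sg; destruct Rle_dec; lra).
    assert (Hsa : sg * a = Rabs a)
      by (unfold sg; destruct Rle_dec;
          [rewrite Rabs_pos_eq | rewrite Rabs_left]; lra).
    rewrite (RInt_inv_sub a r (sg * sqrt (a ^ 2 - r ^ 2))).
    + rewrite Rpower_Ropp. replace (1 / 2) with (/ 2) by lra.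
      rewrite Rpower_sqrt by auto.
      assert (sg <> 0) by nra.
      replace (/ (sqrt (a ^ 2 - r ^ 2))) with (/ (sg * sqrt (a ^ 2 - r ^ 2)) * sg)
        by (field; lra).
      transitivity (- (2 * PI) / (sg * sqrt (a ^ 2 - r ^ 2)) * (sg * sg));
        [rewrite Hsg; ring | unfold Rdiv; ring].
    + lra.
    + rewrite Rpow_mult_distr, pow2_sqrt by lra.
      replace (sg ^ 2) with (sg * sg) by ring. rewrite Hsg. ring.
    + replace (sg * sqrt (a ^ 2 - r ^ 2) * a) with (sqrt (a ^ 2 - r ^ 2) * (sg * a)) by ring.
      rewrite Hsa. apply Rmult_lt_0_compat; lra.
    + intros t. apply denominator_nonzero; auto.
Qed.

(** The integrand is minus the logarithmic derivative of r co t - b, with a periodic antiderivative,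
    so the integral is 0. The square inside [ln] avoids a distinction on the sign of the
    denominator. *)
Lemma class_ratio_zero (k0 k : nat) (b : R) : In (Rabs b) us ->
  integral_class k0 k (fun r t => r * si t / (r * co t - b)).
Proof.
  intros Hb.
  assert (K : forall r, 0 < r < rho -> forall t,
    continuous (fun t => r * si t / (r * co t - b)) t).
  { intros r Hr t. apply @ex_derive_continuous. auto_derive.
    split; [exists (co t); apply si_derive|]. split; [exists (- si t); apply co_derive|].
    split; [apply (denominator_nonzero b r t Hb Hr) | exact I]. }
  split; [exact K|].
  exists (fun _ => 0), (fun _ _ => 0). repeat split; auto using is_poly_0.
  intros r Hr. rewrite <- (lsum_scal us 0 (fun u => Rpower _ _)).
  rewrite (RInt_derive_R (fun t => - / 2 * ln ((r * co t - b) ^ 2))).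
  - rewrite co_periodic. ring.
  - intros t. assert (Nz := denominator_nonzero b r t Hb Hr).
    assert (P : 0 < (r * co t - b) ^ 2) by (apply pow2_gt_0; auto).
    auto_derive.
    + split; [eexists; eauto|]. simpl in P. auto.
    + replace (Derive (fun x => co x) t) with (- si t)
        by (symmetry; apply is_derive_unique, co_derive).
      field. auto.
  - auto.
Qed.

(** Put x = r co t and y = r si t. Powers of x go first, through x / (x - b) = 1 + b / (x - b). Then
    y^2 = (r^2 - b^2) - (x - b)(x + b) lowers i by 2 and raises both counts by 1, down to the base
    cases i = 0 (Poisson) and i = 1 (logarithm). *)
Lemma class_monomial_div (b : R) (i j : nat) : In (Rabs b) us ->
  integral_class ((i + j + 1) / 2) (i / 2 + 1)
    (fun r t => (r * si t) ^ i * (r * co t) ^ j / (r * co t - b)).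
Proof.
  intros Hb. revert i.
  induction j as [|j IHj].
  - intros i. induction i as [i IHi] using lt_wf_ind.
    destruct i as [|[|i]].
    + simpl. apply class_ext with (2 := class_inv_sub b Hb).
      intros r t _. unfold Rdiv. ring.
    + apply class_le with 0%nat 0%nat; [simpl; lia | simpl; lia |].
      apply class_ext with (2 := class_ratio_zero 0 0 b Hb).
      intros r t _. simpl. unfold Rdiv. ring.
    + assert (E1 : ((S (S i) + 0 + 1) / 2 = S ((i + 0 + 1) / 2))%nat).
      { replace (S (S i) + 0 + 1)%nat with (i + 0 + 1 + 1 * 2)%nat by lia.
        rewrite Nat.div_add by lia. lia. }
      assert (E2 : (S (S i) / 2 = S (i / 2))%nat).
      { replace (S (S i)) with (i + 1 * 2)%nat by lia.
        rewrite Nat.div_add by lia. lia. }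
      rewrite E1, E2.
      apply class_ext with (fun r t =>
        ((-1) * ((b ^ 2 - r ^ 2) * ((r * si t) ^ i * (r * co t) ^ 0 / (r * co t - b)))
        - (r * si t) ^ i * (r * co t) ^ 1)
        - b * ((r * si t) ^ i * (r * co t) ^ 0)).
      { intros r t Hr. assert (Nz := denominator_nonzero b r t Hb Hr).
        replace ((r * si t) ^ S (S i)) with ((r * si t) ^ i * (r ^ 2 * si t ^ 2))
          by (simpl; ring).
        replace (si t ^ 2) with (1 - co t ^ 2) by (rewrite <- (circle t); ring).
        simpl. field. auto. }
      repeat apply class_minus.
      * apply class_scal, class_sub_square, IHi. lia.
      * apply class_monomial. rewrite !Nat.add_0_r. lia.
      * apply class_scal, class_monomial.
        rewrite !Nat.add_0_r. apply Nat.lt_succ_r, Nat.Div0.div_le_mono. lia.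
  - intros i. specialize (IHj i).
    apply class_ext with (fun r t =>
      b * ((r * si t) ^ i * (r * co t) ^ j / (r * co t - b))
      + (r * si t) ^ i * (r * co t) ^ j).
    { intros r t Hr. assert (Nz := denominator_nonzero b r t Hb Hr).
      simpl. field. auto. }
    assert (E : ((i + S j + 1) / 2 = S ((i + j) / 2))%nat).
    { replace (i + S j + 1)%nat with (i + j + 1 * 2)%nat by lia.
      rewrite Nat.div_add by lia. lia. }
    apply class_plus.
    + apply class_scal. apply class_le with (3 := IHj); auto.
      apply Nat.Div0.div_le_mono. lia.
    + apply class_monomial. lia.
Qed.

End Rotation.
End IntegralClass.

(** * Reduction of the Abelian integral *)

Lemma prod_lin_remove (l : list R) (v : R) : In v l ->
  exists l', length l = S (length l') /\
    forall s, prod_lin l s = (s - v) * prod_lin l' s.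
Proof.
  induction l as [|w l IH]; [intros []|]. intros [->|H].
  - exists l. auto.
  - destruct (IH H) as (l' & Hl & E). exists (w :: l'). simpl. split; auto.
    intros s. rewrite E. ring.
Qed.

(** No residues are computed: 1 / ((x - a)(x - a')) = (1 / (x - a) - 1 / (x - a')) / (a - a')
    replaces a product by two that are one factor shorter, and the class is closed under linear
    combinations. *)
Lemma class_partial_fractions (rho : R) (us : list R) (k0 k : nat)
    (f g : R -> R -> R) : forall l : list R, l <> nil -> NoDup l ->
  (forall a r t, In a l -> 0 < r < rho -> f r t - a <> 0) ->
  (forall a, In a l -> integral_class rho us k0 k (fun r t => g r t / (f r t - a))) ->
  integral_class rho us k0 k (fun r t => g r t / prod_lin l (f r t)).
Proof.
  intros l. remember (length l) as m eqn:Hm. revert l Hm.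
  induction m as [|m IH]; intros [|a [|a' l]] Hm Hne Hd Hf Hg; try easy.
  - apply class_ext with (2 := Hg a (or_introl eq_refl)).
    intros r t Hr. simpl. rewrite Rmult_1_r. reflexivity.
  - inversion Hd as [|? ? Ha Hd']; subst. inversion Hd' as [|? ? Ha' Hd'']; subst.
    assert (Haa : a - a' <> 0).
    { apply Rminus_eq_contra. intros ->. apply Ha. simpl; auto. }
    apply class_ext with (fun r t => / (a - a') *
      (g r t / prod_lin (a :: l) (f r t) - g r t / prod_lin (a' :: l) (f r t))).
    + intros r t Hr. simpl.
      assert (N1 : f r t - a <> 0) by (apply Hf; simpl; auto).
      assert (N2 : f r t - a' <> 0) by (apply Hf; simpl; auto).
      assert (N3 : prod_lin l (f r t) <> 0).
      { apply prod_lin_nonzero. intros v Hv E.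
        apply (Hf v r t); simpl; auto. lra. }
      field. auto.
    + simpl in Hm. apply class_scal, class_minus; apply IH; simpl; try lia; try easy.
      * constructor; auto. intro; apply Ha; simpl; auto.
      * intros v r t [|]; apply Hf; simpl; auto.
      * intros v [|]; apply Hg; simpl; auto.
      * intros v r t [|]; apply Hf; simpl; auto.
      * intros v [|]; apply Hg; simpl; auto.
Qed.

Lemma class_poly2 (rho : R) (us : list R) (k0 k n : nat) (c : nat -> nat -> R)
    (x y h : R -> R -> R) :
  (forall i j, (i + j <= n)%nat ->
     integral_class rho us k0 k (fun r t => x r t ^ i * y r t ^ j * h r t)) ->
  integral_class rho us k0 k (fun r t => poly2 n c (x r t) (y r t) * h r t).
Proof.
  intros H.
  apply class_ext with (fun r t => sum_f_R0 (fun i => sum_f_R0 (fun j =>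
    c i j * (x r t ^ i * y r t ^ j * h r t)) (n - i)) n).
  - intros r t _. unfold poly2. rewrite Rmult_comm, scal_sum.
    apply sum_eq. intros i _. rewrite Rmult_comm, scal_sum.
    apply sum_eq. intros j _. ring.
  - apply (class_sum rho us k0 k (fun i r t => sum_f_R0 (fun j =>
      c i j * (x r t ^ i * y r t ^ j * h r t)) (n - i))).
    intros i Hi.
    apply (class_sum rho us k0 k (fun j r t =>
      c i j * (x r t ^ i * y r t ^ j * h r t))).
    intros j Hj. apply class_scal, H. lia.
Qed.

(** * Monomials over the factors of G *)

Section Circle.

Variables (rho : R) (us : list R).
Hypothesis us_NoDup : NoDup us.
Hypothesis us_large : forall u, In u us -> rho <= u.

Lemma cos_sub_nonzero (a r t : R) :
  In (Rabs a) us -> 0 < r < rho -> r * cos t - a <> 0.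
Proof.
  apply (denominator_nonzero rho us us_large cos sin).
  intros u. rewrite <- (sin2_cos2 u). unfold Rsqr. ring.
Qed.

Lemma sin_sub_nonzero (b r t : R) :
  In (Rabs b) us -> 0 < r < rho -> r * sin t - b <> 0.
Proof.
  apply (denominator_nonzero rho us us_large sin cos).
  intros u. rewrite <- (sin2_cos2 u). unfold Rsqr. ring.
Qed.

Lemma class_div_x (a : R) (i j : nat) : In (Rabs a) us ->
  integral_class rho us ((i + j + 1) / 2) (j / 2 + 1)
    (fun r t => (r * cos t) ^ i * (r * sin t) ^ j / (r * cos t - a)).
Proof.
  intros Ha.
  apply class_ext with (fun r t =>
    (r * sin t) ^ j * (r * cos t) ^ i / (r * cos t - a)).
  { intros. f_equal. ring. }
  rewrite (Nat.add_comm i j).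
  apply (class_monomial_div rho us us_NoDup us_large cos sin); auto.
  - intros t. auto_derive; auto; ring.
  - intros t. auto_derive; auto; ring.
  - intros t. rewrite <- (sin2_cos2 t). unfold Rsqr. ring.
  - intros t. apply neg_cos.
  - intros t. apply neg_sin.
Qed.

Lemma class_div_y (b : R) (i j : nat) : In (Rabs b) us ->
  integral_class rho us ((i + j + 1) / 2) (i / 2 + 1)
    (fun r t => (r * cos t) ^ i * (r * sin t) ^ j / (r * sin t - b)).
Proof.
  intros Hb.
  apply class_ext with (fun r t => (-1) ^ i *
    ((r * - cos t) ^ i * (r * sin t) ^ j / (r * sin t - b))).
  { intros r t _. replace (r * - cos t) with ((-1) * (r * cos t)) by ring.
    rewrite (Rpow_mult_distr (-1)).
    assert (E : (-1) ^ i * (-1) ^ i = 1).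
    { rewrite <- Rpow_mult_distr. replace (-1 * -1) with 1 by ring. apply pow1. }
    unfold Rdiv. rewrite <- !Rmult_assoc, E. ring. }
  apply class_scal.
  apply (class_monomial_div rho us us_NoDup us_large sin (fun t => - cos t)); auto.
  - intros t. auto_derive; auto; ring.
  - intros t. auto_derive; auto; ring.
  - intros t. rewrite <- (sin2_cos2 t). unfold Rsqr. ring.
  - intros t. apply neg_sin.
  - intros t. rewrite neg_cos. ring.
Qed.

Lemma div2_le (i j : nat) : (i <= j)%nat -> (i / 2 <= j / 2)%nat.
Proof. intros; apply Nat.Div0.div_le_mono; auto. Qed.

Lemma div2_SS (i : nat) : (S (S i) / 2 = S (i / 2))%nat.
Proof.
  replace (S (S i)) with (i + 1 * 2)%nat by lia. rewrite Nat.div_add by lia. lia.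
Qed.

(** Splitting y = b + (y - b) or x = a + (x - a) lowers the monomial; the remainder has one
    denominator and degree at most n, and the factor a^2 + b^2 - r^2 adds 1 to each of its counts.
    For the monomial 1 that factor equals (a^2 - x^2) + (b^2 - y^2), whose two parts each cancel a
    denominator. *)
Lemma class_div_xy (n : nat) (a b : R) :
  In (Rabs a) us -> In (Rabs b) us ->
  forall i j, (i + j <= n + 1)%nat ->
  integral_class rho us ((n + 1) / 2 + 1) ((n + 2) / 2 + 1)
    (fun r t => (a ^ 2 + b ^ 2 - r ^ 2) *
       ((r * cos t) ^ i * (r * sin t) ^ j / ((r * cos t - a) * (r * sin t - b)))).
Proof.
  intros Ha Hb.
  assert (E2 : ((n + 2) / 2 = S (n / 2))%nat)
    by (replace (n + 2)%nat with (S (S n)) by lia; apply div2_SS).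
  induction i as [|i IHi].
  - induction j as [|j IHj]; intros Hij.
    + apply class_ext with (fun r t =>
        (-1) * ((r * cos t) ^ 1 * (r * sin t) ^ 0 / (r * sin t - b))
        + (- a) * ((r * cos t) ^ 0 * (r * sin t) ^ 0 / (r * sin t - b))
        + (-1) * ((r * cos t) ^ 0 * (r * sin t) ^ 1 / (r * cos t - a))
        + (- b) * ((r * cos t) ^ 0 * (r * sin t) ^ 0 / (r * cos t - a))).
      { intros r t Hr.
        assert (N1 := cos_sub_nonzero a r t Ha Hr).
        assert (N2 := sin_sub_nonzero b r t Hb Hr).
        replace (a ^ 2 + b ^ 2 - r ^ 2) with
          (a ^ 2 + b ^ 2 - ((r * cos t) ^ 2 + (r * sin t) ^ 2)).
        - simpl. field. auto.
        - replace (r ^ 2) with (r ^ 2 * (Rsqr (sin t) + Rsqr (cos t)))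
            by (rewrite sin2_cos2; ring).
          unfold Rsqr. ring. }
      assert (H1 : (1 <= (n + 1) / 2 + 1)%nat) by lia.
      repeat apply class_plus; apply class_scal;
        (eapply class_le; [| |apply class_div_x || apply class_div_y]; auto);
        simpl; lia.
    + apply class_ext with (fun r t =>
        b * ((a ^ 2 + b ^ 2 - r ^ 2) *
          ((r * cos t) ^ 0 * (r * sin t) ^ j / ((r * cos t - a) * (r * sin t - b))))
        + (a ^ 2 + b ^ 2 - r ^ 2) *
          ((r * cos t) ^ 0 * (r * sin t) ^ j / (r * cos t - a))).
      { intros r t Hr.
        assert (N1 := cos_sub_nonzero a r t Ha Hr).
        assert (N2 := sin_sub_nonzero b r t Hb Hr).
        simpl. field. auto. }
      apply class_plus; [apply class_scal, IHj; lia|].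
      eapply class_le; [| |apply class_sub_square, class_div_x; auto].
      * assert ((0 + j + 1) / 2 <= (n + 1) / 2)%nat by (apply div2_le; lia). lia.
      * rewrite E2. assert (j / 2 <= n / 2)%nat by (apply div2_le; lia). lia.
  - intros j Hij.
    apply class_ext with (fun r t =>
      a * ((a ^ 2 + b ^ 2 - r ^ 2) *
        ((r * cos t) ^ i * (r * sin t) ^ j / ((r * cos t - a) * (r * sin t - b))))
      + (a ^ 2 + b ^ 2 - r ^ 2) *
        ((r * cos t) ^ i * (r * sin t) ^ j / (r * sin t - b))).
    { intros r t Hr.
      assert (N1 := cos_sub_nonzero a r t Ha Hr).
      assert (N2 := sin_sub_nonzero b r t Hb Hr).
      simpl. field. auto. }
    apply class_plus; [apply class_scal, IHi; lia|].
    eapply class_le; [| |apply class_sub_square, class_div_y; auto].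
    + assert ((i + j + 1) / 2 <= (n + 1) / 2)%nat by (apply div2_le; lia). lia.
    + rewrite E2. assert (i / 2 <= n / 2)%nat by (apply div2_le; lia). lia.
Qed.

(** The factor [prod_lin nil] is 1; it gives this case the shape that [zeros_abelian_I] expects. *)
Lemma class_div_G_x (n : nat) (la : list R) (i j : nat) :
  la <> nil -> NoDup la -> (forall a, In a la -> In (Rabs a) us) ->
  (i + j <= n + 1)%nat ->
  integral_class rho us ((n + 2) / 2) ((n + 1) / 2 + 1)
    (fun r t => prod_lin nil (r ^ 2) *
       ((r * cos t) ^ i * (r * sin t) ^ j / Gfun la nil (r * cos t) (r * sin t))).
Proof.
  intros Hne Hd Hla Hij.
  apply class_ext with (fun r t =>
    (r * cos t) ^ i * (r * sin t) ^ j / prod_lin la (r * cos t)).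
  { intros r t _. unfold Gfun. simpl. rewrite Rmult_1_l, Rmult_1_r. reflexivity. }
  apply (class_partial_fractions rho us _ _ (fun r t => r * cos t)
    (fun r t => (r * cos t) ^ i * (r * sin t) ^ j)); auto.
  - intros a r t Ha Hr. apply cos_sub_nonzero; auto.
  - intros a Ha. eapply class_le; [| |apply class_div_x; auto].
    + apply div2_le. lia.
    + apply Nat.add_le_mono_r, div2_le. lia.
Qed.

(** Partial fractions in y, then in x, leave one pair (a, b) at a time. The factor of [prod_lin vs]
    at a^2 + b^2 is spent on [class_div_xy]; each of the others adds 1 to both counts. *)
Lemma class_div_G_xy (n : nat) (la lb vs : list R) (i j : nat) :
  la <> nil -> lb <> nil -> NoDup la -> NoDup lb ->
  (forall a, In a la -> In (Rabs a) us) -> (forall b, In b lb -> In (Rabs b) us) ->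
  (forall a b, In a la -> In b lb -> In (a ^ 2 + b ^ 2) vs) ->
  (i + j <= n + 1)%nat ->
  integral_class rho us ((n + 1) / 2 + length vs) ((n + 2) / 2 + length vs)
    (fun r t => prod_lin vs (r ^ 2) *
       ((r * cos t) ^ i * (r * sin t) ^ j / Gfun la lb (r * cos t) (r * sin t))).
Proof.
  intros Hnea Hneb Hda Hdb Hla Hlb Hvs Hij.
  apply class_ext with (fun r t =>
    prod_lin vs (r ^ 2) * ((r * cos t) ^ i * (r * sin t) ^ j)
      / prod_lin la (r * cos t) / prod_lin lb (r * sin t)).
  { intros r t Hr. unfold Gfun.
    assert (Na : prod_lin la (r * cos t) <> 0).
    { apply prod_lin_nonzero. intros a Ha E.
      apply (cos_sub_nonzero a r t); auto. lra. }
    assert (Nb : prod_lin lb (r * sin t) <> 0).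
    { apply prod_lin_nonzero. intros b Hb E.
      apply (sin_sub_nonzero b r t); auto. lra. }
    field. auto. }
  apply (class_partial_fractions rho us _ _ (fun r t => r * sin t)
    (fun r t => prod_lin vs (r ^ 2) * ((r * cos t) ^ i * (r * sin t) ^ j)
      / prod_lin la (r * cos t))); auto.
  { intros b r t Hb Hr. apply sin_sub_nonzero; auto. }
  intros b Hb.
  apply class_ext with (fun r t =>
    prod_lin vs (r ^ 2) * ((r * cos t) ^ i * (r * sin t) ^ j)
      / (r * sin t - b) / prod_lin la (r * cos t)).
  { intros. unfold Rdiv. ring. }
  apply (class_partial_fractions rho us _ _ (fun r t => r * cos t)
    (fun r t => prod_lin vs (r ^ 2) * ((r * cos t) ^ i * (r * sin t) ^ j)
      / (r * sin t - b))); auto.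
  { intros a r t Ha Hr. apply cos_sub_nonzero; auto. }
  intros a Ha.
  destruct (prod_lin_remove vs _ (Hvs a b Ha Hb)) as (vs' & Hl & Ev).
  rewrite Hl.
  apply class_ext with (fun r t => (-1) * (prod_lin vs' (r ^ 2) *
    ((a ^ 2 + b ^ 2 - r ^ 2) *
      ((r * cos t) ^ i * (r * sin t) ^ j / ((r * cos t - a) * (r * sin t - b)))))).
  { intros r t Hr. rewrite Ev.
    assert (N1 := cos_sub_nonzero a r t (Hla a Ha) Hr).
    assert (N2 := sin_sub_nonzero b r t (Hlb b Hb) Hr).
    field. auto. }
  eapply class_le;
    [| |apply class_scal, class_prod_lin, class_div_xy; auto; exact Hij]; lia.
Qed.

End Circle.

(** * From monomials to the bound *)

Lemma rho_le (la lb : list R) (u : R) :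
  In u (la ++ lb) -> rho la lb <= Rabs u.
Proof.
  unfold rho. generalize (Rabs (hd 0 la)) as m. generalize (la ++ lb) as l.
  induction l as [|v l IH]; [intros _ []|]. intros m [->|H]; simpl.
  - apply Rmin_l.
  - eapply Rle_trans; [apply Rmin_r | apply IH, H].
Qed.

(** P and Q enter multiplied by x and y, hence monomials up to degree n + 1. The product over [vs]
    does not depend on t, so it leaves the integral, and it is nonzero since r^2 stays below every
    v. *)
Lemma zeros_abelian_I (la lb us vs : list R) (n k0 k : nat)
    (cP cQ : nat -> nat -> R) :
  (forall u, In u us -> rho la lb <= u) ->
  (forall v, In v vs -> rho la lb ^ 2 <= v) ->
  (forall i j, (i + j <= n + 1)%nat ->
     integral_class (rho la lb) us k0 (S k) (fun r t => prod_lin vs (r ^ 2) *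
       ((r * cos t) ^ i * (r * sin t) ^ j / Gfun la lb (r * cos t) (r * sin t)))) ->
  (exists r, 0 < r < rho la lb /\
     abelian_I la lb (poly2 n cP) (poly2 n cQ) r <> 0) ->
  forall zs : list (R * nat), NoDup (map fst zs) ->
  (forall z, In z zs -> 0 < fst z < rho la lb /\
     forall m, (m < snd z)%nat ->
       Derive_n (abelian_I la lb (poly2 n cP) (poly2 n cQ)) m (fst z) = 0) ->
  (sum_mult zs < k0 + length us * S k)%nat.
Proof.
  intros Hus Hvs Hmon Hex.
  assert (rho_pos : 0 < rho la lb) by (destruct Hex as (r & Hr & _); lra).
  set (N := fun r t => poly2 n cQ (r * cos t) (r * sin t) * (- r * sin t)
                     - poly2 n cP (r * cos t) (r * sin t) * (r * cos t)).
  assert (Hclass : integral_class (rho la lb) us k0 (S k) (fun r t =>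
    prod_lin vs (r ^ 2) * (N r t / Gfun la lb (r * cos t) (r * sin t)))).
  { apply class_ext with (fun r t =>
      poly2 n cQ (r * cos t) (r * sin t) *
        (prod_lin vs (r ^ 2) * (- r * sin t) / Gfun la lb (r * cos t) (r * sin t))
      - poly2 n cP (r * cos t) (r * sin t) *
        (prod_lin vs (r ^ 2) * (r * cos t) / Gfun la lb (r * cos t) (r * sin t))).
    { intros r t _. unfold N, Rdiv. ring. }
    apply class_minus.
    - apply (class_poly2 _ us k0 (S k) n cQ (fun r t => r * cos t) (fun r t => r * sin t)
        (fun r t => prod_lin vs (r ^ 2) * (- r * sin t)
           / Gfun la lb (r * cos t) (r * sin t))).
      intros i j Hij. apply class_ext with
        (2 := class_scal _ _ _ _ (-1) _ (Hmon i (S j) ltac:(lia))).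
      intros r t _. simpl. unfold Rdiv. ring.
    - apply (class_poly2 _ us k0 (S k) n cP (fun r t => r * cos t) (fun r t => r * sin t)
        (fun r t => prod_lin vs (r ^ 2) * (r * cos t)
           / Gfun la lb (r * cos t) (r * sin t))).
      intros i j Hij. apply class_ext with (2 := Hmon (S i) j ltac:(lia)).
      intros r t _. simpl. unfold Rdiv. ring. }
  destruct Hclass as (K & p & ps & Hp & Hps & E).
  apply (zero_count (rho la lb) vs us _ k0 k p ps (1 / 2)); auto.
  - intros u Hu. specialize (Hus u Hu). nra.
  - intros r Hr. rewrite <- E by auto. unfold abelian_I.
    assert (ND : prod_lin vs (r ^ 2) <> 0).
    { apply prod_lin_nonzero. intros v Hv E0. specialize (Hvs v Hv). nra. }
    assert (E1 : forall t, N r t / Gfun la lb (r * cos t) (r * sin t)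
      = / prod_lin vs (r ^ 2) * (prod_lin vs (r ^ 2) *
         (N r t / Gfun la lb (r * cos t) (r * sin t)))).
    { intros t. rewrite <- (Rmult_assoc (/ _)), Rinv_l by auto. ring. }
    rewrite (RInt_ext _ _ _ _ (fun t _ => E1 t)), RInt_scal_R by auto.
    rewrite <- Rmult_assoc, Rinv_r by auto. apply Rmult_1_l.
Qed.

Lemma card_abs (la lb : list R) :
  (K1t la + K2t la lb)%nat = card_R (map Rabs la ++ map Rabs lb).
Proof.
  unfold K2t. enough (K1t la <= card_R (map Rabs la ++ map Rabs lb))%nat by lia.
  apply NoDup_incl_length; [apply NoDup_nodup|].
  intros x Hx. rewrite nodup_In in *. apply in_or_app. auto.
Qed.

Theorem theorem1p1 (la lb : list R) (n : nat) (cP cQ : nat -> nat -> R) :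
  (length lb <= length la)%nat ->
  (1 <= length la)%nat ->
  NoDup la -> NoDup lb ->
  (forall a, In a la -> a <> 0) ->
  (forall b, In b lb -> b <> 0) ->
  (exists r, 0 < r < rho la lb /\
     abelian_I la lb (poly2 n cP) (poly2 n cQ) r <> 0) ->
  forall zs : list (R * nat),
    NoDup (map fst zs) ->
    (forall z, In z zs ->
       0 < fst z < rho la lb /\
       forall k, (k < snd z)%nat ->
         Derive_n (abelian_I la lb (poly2 n cP) (poly2 n cQ)) k (fst z) = 0) ->
    (Z.of_nat (sum_mult zs) <= zero_bound n la lb)%Z.
Proof.
  intros _ Hla Hda Hdb _ _ Hex zs Hzd Hz.
  assert (Hnea : la <> nil) by (intros ->; simpl in Hla; lia).
  assert (rho_pos : 0 < rho la lb) by (destruct Hex as (r & Hr & _); lra).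
  set (us := nodup Req_dec_T (map Rabs la ++ map Rabs lb)).
  assert (Hus : forall u, In u us -> rho la lb <= u).
  { intros u Hu. apply nodup_In in Hu. rewrite <- map_app in Hu.
    apply in_map_iff in Hu. destruct Hu as (w & <- & Hw). apply rho_le, Hw. }
  assert (Husd : NoDup us) by apply NoDup_nodup.
  assert (Hau : forall a, In a la -> In (Rabs a) us).
  { intros a Ha. apply nodup_In, in_or_app. left. apply in_map, Ha. }
  assert (Hbu : forall b, In b lb -> In (Rabs b) us).
  { intros b Hb. apply nodup_In, in_or_app. right. apply in_map, Hb. }
  destruct lb as [|b0 lb].
  (* Here [(n+1)/2] + 1 = [(n+3)/2] and [(n+2)/2] = [n/2] + 1; the latter unit turns the strict
     bound into the stated one. *)
  - assert (H : (sum_mult zs < (n + 2) / 2 + length us * S ((n + 1) / 2))%nat).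
    { apply (zeros_abelian_I la nil us nil n _ _ cP cQ); auto; [easy|].
      intros i j Hij. replace (S ((n + 1) / 2)) with ((n + 1) / 2 + 1)%nat by lia.
      apply class_div_G_x; auto. }
    assert (EK : length us = K1t la).
    { unfold us, K1t, card_R. simpl map at 2. rewrite app_nil_r. reflexivity. }
    rewrite EK in H. apply Nat2Z.inj_lt in H.
    rewrite Nat2Z.inj_add, Nat2Z.inj_mul, Nat2Z.inj_succ, !Nat2Z.inj_div in H.
    unfold zero_bound.
    replace ((Z.of_nat n + 3) / 2)%Z with (Z.succ (Z.of_nat (n + 1) / Z.of_nat 2))%Z
      by (Z.to_euclidean_division_equations; lia).
    assert (Z.of_nat (n + 2) / Z.of_nat 2 = Z.of_nat n / 2 + 1)%Z
      by (Z.to_euclidean_division_equations; lia).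
    lia.
  - set (lb1 := b0 :: lb) in *.
    set (vs := nodup Req_dec_T (flat_map (fun a => map (fun b => a ^ 2 + b ^ 2) lb1) la)).
    assert (Hvs : forall v, In v vs <->
      exists a b, In a la /\ In b lb1 /\ a ^ 2 + b ^ 2 = v).
    { intros v. unfold vs. rewrite nodup_In, in_flat_map. split.
      - intros (a & Ha & Hv). apply in_map_iff in Hv.
        destruct Hv as (b & Eb & Hb). eauto.
      - intros (a & b & Ha & Hb & Eb). exists a. split; auto.
        apply in_map_iff. eauto. }
    (* As [vs] is nonempty, the count [(n+2)/2] + [length vs] is a successor, the form S k that
       [zeros_abelian_I] takes. *)
    destruct (length vs) as [|l] eqn:Hl.
    { exfalso. destruct la as [|a0 la]; [easy|].
      assert (Hv : In (a0 ^ 2 + b0 ^ 2) vs)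
        by (apply Hvs; exists a0, b0; unfold lb1; simpl; auto).
      destruct vs; easy. }
    assert (H : (sum_mult zs < (n + 1) / 2 + length vs
                  + length us * S ((n + 2) / 2 + l))%nat).
    { apply (zeros_abelian_I la lb1 us vs n _ _ cP cQ); auto.
      - intros v Hv. apply Hvs in Hv. destruct Hv as (a & b & Ha & _ & <-).
        assert (rho la lb1 <= Rabs a) by (apply rho_le, in_or_app; auto).
        rewrite <- (pow2_abs a). nra.
      - intros i j Hij. rewrite <- Nat.add_succ_r, <- Hl.
        apply class_div_G_xy; auto; [easy|].
        intros a b Ha Hb. apply Hvs. eauto. }
    assert (EK : length us = (K1t la + K2t la lb1)%nat) by (rewrite card_abs; reflexivity).
    assert (EL : Lcard la lb1 = S l) by (rewrite <- Hl; reflexivity).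
    rewrite EK, Hl in H. apply Nat2Z.inj_lt in H.
    rewrite Nat2Z.inj_add, Nat2Z.inj_mul, Nat2Z.inj_succ, !Nat2Z.inj_add,
      !Nat2Z.inj_div in H.
    change (zero_bound n la lb1) with
      (Z.of_nat (K1t la + K2t la lb1) * ((Z.of_nat n + 2) / 2 + Z.of_nat (Lcard la lb1))
          + (Z.of_nat n - 1) / 2 + Z.of_nat (Lcard la lb1))%Z.
    rewrite EL, Nat2Z.inj_add.
    replace ((Z.of_nat n + 2) / 2 + Z.of_nat (S l))%Z with
      (Z.succ ((Z.of_nat n + Z.of_nat 2) / Z.of_nat 2 + Z.of_nat l))%Z
      by (change (Z.of_nat 2) with 2%Z; lia).
    (* Division in [Z] rounds down, so this also holds at n = 0, where (n - 1) / 2 is -1. The unit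
       again absorbs the strict inequality. *)
    assert ((Z.of_nat n + Z.of_nat 1) / Z.of_nat 2 = (Z.of_nat n - 1) / 2 + 1)%Z
      by (Z.to_euclidean_division_equations; lia).
    lia.
Qed.
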